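(* Let $l\geq 1$ be an integer and let $q\in\mathbb{C}$ be a primitive root of unity of order $l$ with $l$ odd, or of order $2l$ with $l$ even. Then $A(SL_q(2))$ is a free module of rank $l^3$ over the coordinate ring $A(SL(2))$ of the classical group, both as a left module and as a right module. In each case, the $l^3$ free generators (i.e. a basis) can be chosen as the monomials $$a^m b^n c^{s'},\qquad b^n c^{s''} d^r,$$ with the integers $m,n,r,s',s''$ in the range $$1\le m\le l-1;\quad 0\le n,r\le l-1;\quad m\le s'\le l-1;\quad 0\le s''\le l-r-1.$$
   Context: For $0\neq q\in\mathbb{C}$, $A(SL_q(2))$ is the quotient of the free unital associative algebra $\mathbb{C}\langle a,b,c,d\rangle$ by the two-sided ideal generated by the relations $$ab=qba,\quad ac=qca,\quad bd=qdb,\quad bc=cb,\quad cd=qdc,\quad ad-da=(q-q^{-1})bc,\quad ad-qbc=1.$$ When $q$ is a primitive root of unity of odd order $l$, or of order $2l$ with $l$ even, the elements $\alpha=a^l$, $\beta=b^l$, $\gamma=c^l$, $\delta=d^l$ generate a (commutative) subalgebra of $A(SL_q(2))$ isomorphic to $$A(SL(2))=\mathbb{C}[\alpha,\beta,\gamma,\delta]/\langle \alpha\delta-\beta\gamma-1\rangle,$$ the coordinate ring of the classical group $SL(2)=SL(2,\mathbb{C})$. This subalgebra is identified with $A(SL(2))$, and $A(SL_q(2))$ is a left (resp. right) $A(SL(2))$-module by left (resp. right) multiplication. (For even $l$ the left and right module structures differ.) *)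

(* Defs.v *)
From HB Require Import structures.
From mathcomp Require Import all_boot all_order all_algebra.
From mathcomp Require Import finmap boolp reals complex.
From mathcomp Require Import mpoly.
From mathcomp Require Import monalg.

Set Implicit Arguments.
Unset Strict Implicit.
Unset Printing Implicit Defensive.

Import GRing.Theory.
Local Open Scope ring_scope.
Local Open Scope quotient_scope.

Section TwoSidedIdeal.
Variable A : nzRingType.

(* Two-sided ideal generated by rels: the finite sums of products x * u * y. *)
Inductive in_ideal (rels : seq A) : A -> Prop :=
| in_ideal0 : in_ideal rels 0
| in_idealD x u y z :
    u \in rels -> in_ideal rels z -> in_ideal rels (x * u * y + z).

(* Properness is recorded because an nzRingType must satisfy 1 != 0. *)
Record presentation := Presentation {
  relators :> seq A;
  presentation_proper : ~ in_ideal relators 1 }.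

Variable P : presentation.

Definition ideal : {pred A} := fun x => `[< in_ideal P x >].

Lemma idealP x : reflect (in_ideal P x) (x \in ideal).
Proof. exact: asboolP. Qed.

Lemma idealDs x y : x \in ideal -> y \in ideal -> x + y \in ideal.
Proof.
move=> /idealP Px /idealP Py; apply/idealP; elim: Px => [|a u b z Pu _ IH].
  by rewrite add0r.
by rewrite -addrA; constructor.
Qed.

Lemma idealMl x y : y \in ideal -> x * y \in ideal.
Proof.
move=> /idealP Py; apply/idealP; elim: Py => [|a u b z Pu _ IH].
  by rewrite mulr0; constructor.
by rewrite mulrDr !mulrA; constructor.
Qed.

Lemma idealMr x y : x \in ideal -> x * y \in ideal.
Proof.
move=> /idealP Px; apply/idealP; elim: Px => [|a u b z Pu _ IH].
  by rewrite mul0r; constructor.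
by rewrite mulrDl -mulrA; constructor.
Qed.

Lemma ideal_zmod_closed : zmod_closed ideal.
Proof.
split=> [|x y Px Py]; first by apply/idealP; constructor.
by apply: idealDs => //; rewrite -mulN1r; apply: idealMl.
Qed.

HB.instance Definition _ := GRing.isZmodClosed.Build A ideal ideal_zmod_closed.

Lemma ideal_relator u : u \in relators P -> u \in ideal.
Proof.
move=> Pu; apply/idealP; rewrite -[u]mul1r -[1 * u]mulr1.
by rewrite -[X in in_ideal _ X]addr0; do 2?constructor.
Qed.

End TwoSidedIdeal.

Definition quot_alg (F : comNzRingType) (A : algType F) (P : presentation A) :
  Type := Quotient.quot (ideal P).

Section QuotientAlgebra.
Variables (F : comNzRingType) (A : algType F) (P : presentation A).
Local Notation Q := (quot_alg P).
Local Notation pi := (\pi_(Quotient.quot (ideal P)) : A -> Q).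

HB.instance Definition _ := GRing.Zmodule.on Q.

Definition quot_one : Q := pi 1.
Definition quot_mul (x y : Q) : Q := pi (repr x * repr y).
Definition quot_scale (k : F) (x : Q) : Q := pi (k *: repr x).

Let piP (x y : A) : pi x = pi y <-> x - y \in ideal P.
Proof. by rewrite Quotient.idealrBE; split=> /eqP. Qed.

Let pi_repr (x : A) : repr (pi x) - x \in ideal P.
Proof. by apply/piP; rewrite reprK. Qed.

Let pi_mul x y : pi (x * y) = quot_mul (pi x) (pi y).
Proof.
apply/esym/piP; set u := repr _; set v := repr _.
have -> : u * v - x * y = (u - x) * v + x * (v - y).
  by rewrite mulrBl mulrBr addrA subrK.
by apply: idealDs; [apply: idealMr|apply: idealMl]; apply: pi_repr.
Qed.

Let pi_scale k x : pi (k *: x) = quot_scale k (pi x).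
Proof.
apply/esym/piP; rewrite -scalerBr -mulr_algl.
by apply: idealMl; apply: pi_repr.
Qed.

Let pi_add x y : pi (x + y) = pi x + pi y :> Q.
Proof. exact: Quotient.pi_add. Qed.

Let quotW (T : Q -> Prop) : (forall x, T (pi x)) -> forall x, T x.
Proof. by move=> Tpi x; rewrite -[x]reprK; apply: Tpi. Qed.

Let quot_mulA : associative quot_mul.
Proof.
elim/quotW=> x; elim/quotW=> y; elim/quotW=> z.
by rewrite -!pi_mul mulrA.
Qed.

Let quot_mul1 : left_id quot_one quot_mul.
Proof. by elim/quotW=> x; rewrite -pi_mul mul1r. Qed.

Let quot_mulr1 : right_id quot_one quot_mul.
Proof. by elim/quotW=> x; rewrite -pi_mul mulr1. Qed.

Let quot_mulDl : left_distributive quot_mul +%R.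
Proof.
elim/quotW=> x; elim/quotW=> y; elim/quotW=> z.
by rewrite -!(pi_mul, pi_add) mulrDl.
Qed.

Let quot_mulDr : right_distributive quot_mul +%R.
Proof.
elim/quotW=> x; elim/quotW=> y; elim/quotW=> z.
by rewrite -!(pi_mul, pi_add) mulrDr.
Qed.

Let quot_one_neq0 : quot_one != 0 :> Q.
Proof.
apply/eqP=> e1; have /piP : pi 1 = pi 0 by rewrite raddf0 -e1.
by rewrite subr0 => /idealP; apply: presentation_proper.
Qed.

HB.instance Definition _ := GRing.Zmodule_isNzRing.Build Q
  quot_mulA quot_mul1 quot_mulr1 quot_mulDl quot_mulDr quot_one_neq0.

Let quot_scaleA k m x : quot_scale k (quot_scale m x) = quot_scale (k * m) x.
Proof. by elim/quotW: x => x; rewrite -!pi_scale scalerA. Qed.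

Let quot_scale1 : left_id 1 quot_scale.
Proof. by elim/quotW=> x; rewrite -pi_scale scale1r. Qed.

Let quot_scaleDr : right_distributive quot_scale +%R.
Proof.
move=> k; elim/quotW=> x; elim/quotW=> y.
by rewrite -!(pi_scale, pi_add) scalerDr.
Qed.

Let quot_scaleDl x : {morph quot_scale^~ x : k m / k + m}.
Proof.
by move=> k m; elim/quotW: x => x; rewrite -!(pi_scale, pi_add) scalerDl.
Qed.

HB.instance Definition _ := GRing.Zmodule_isLmodule.Build F Q
  quot_scaleA quot_scale1 quot_scaleDr quot_scaleDl.

Let quot_scaleAl k (x y : Q) : k *: (x * y) = k *: x * y.
Proof.
elim/quotW: x => x; elim/quotW: y => y.
rewrite -[_ * _]pi_mul -[k *: pi x]pi_scale -[LHS]pi_scale -[RHS]pi_mul.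
by rewrite scalerAl.
Qed.

HB.instance Definition _ := GRing.Lmodule_isLalgebra.Build F Q quot_scaleAl.

Let quot_scaleAr k (x y : Q) : k *: (x * y) = x * (k *: y).
Proof.
elim/quotW: x => x; elim/quotW: y => y.
rewrite -[pi x * pi y]pi_mul -[k *: pi y]pi_scale -[LHS]pi_scale -[RHS]pi_mul.
by rewrite scalerAr.
Qed.

HB.instance Definition _ := GRing.Lalgebra_isAlgebra.Build F Q quot_scaleAr.

Definition quot_pi (x : A) : Q := pi x.

Let quot_pi_zmod : zmod_morphism quot_pi.
Proof. by move=> x y; rewrite /quot_pi !raddfB. Qed.

Let quot_pi_monoid : monoid_morphism quot_pi.
Proof. by split=> // x y; apply: pi_mul. Qed.

Let quot_pi_scalable : scalable quot_pi.
Proof. exact: pi_scale. Qed.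

HB.instance Definition _ :=
  GRing.isZmodMorphism.Build A Q quot_pi quot_pi_zmod.
HB.instance Definition _ :=
  GRing.isMonoidMorphism.Build A Q quot_pi quot_pi_monoid.
HB.instance Definition _ :=
  GRing.isScalable.Build F A Q *:%R quot_pi quot_pi_scalable.

Lemma quot_piP x y : quot_pi x = quot_pi y <-> in_ideal P (x - y).
Proof. by split=> [/piP/idealP|/idealP/piP]. Qed.

Lemma quot_pi_surj x : exists y, quot_pi y = x.
Proof. by exists (repr x); apply: reprK. Qed.

End QuotientAlgebra.

Lemma in_ideal_proper (A B : nzRingType) (rels : seq A)
    (f : {rmorphism A -> B}) :
  all (fun u => f u == 0) rels -> ~ in_ideal rels 1.
Proof.
move=> /allP f0 I1; suff: f 1 = 0 by rewrite rmorph1; apply/eqP/oner_neq0.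
elim: I1 => [|x u y z /f0/eqP fu _ fz]; first exact: rmorph0.
by rewrite rmorphD !rmorphM /= fu fz mulr0 mul0r addr0.
Qed.

(* Free unital associative algebra, as the algebra of the free monoid on I.  The
   alias carries the algType structure that {malg F[K]} lacks when the monoid K
   is not commutative. *)
Definition free_alg (F : comNzRingType) (I : choiceType) : Type :=
  {malg F[{fmonom I}]}.

Section FreeAlgebra.
Variables (F : comNzRingType) (I : choiceType).

HB.instance Definition _ := GRing.Lalgebra.on (free_alg F I).

Let free_scaleAr (k : F) (x y : {malg F[{fmonom I}]}) :
  k *: (x * y) = x * (k *: y).
Proof.
apply/malgP=> m; rewrite mcoeffZ.
apply: etrans (congr1 _ (mcoeffMl x y m)) _.
rewrite (mcoeffMlw _ (fsubset_refl _) (msuppZ_le k y)).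
rewrite mulr_sumr; apply: eq_bigr => m1 _; rewrite mulr_sumr.
by apply: eq_bigr => m2 _; rewrite mcoeffZ mulrnAr mulrCA.
Qed.

HB.instance Definition _ :=
  GRing.Lalgebra_isAlgebra.Build F (free_alg F I) free_scaleAr.

Definition free_gen (i : I) : free_alg F I := << fmu i >>.

Variable (S : comNzRingType) (f : {rmorphism F -> S}) (v : I -> S).

Definition fmonom_eval (m : {fmonom I}) : S := \prod_(i <- m : seq I) v i.

Let fmonom_eval_mult : mmorphism fmonom_eval.
Proof.
by split=> [x y|]; rewrite /fmonom_eval ?fmM ?fm1 ?big_cat ?big_nil.
Qed.

HB.instance Definition _ :=
  monalg.isMultiplicative.Build {fmonom I} S fmonom_eval fmonom_eval_mult.

Definition free_eval : {rmorphism free_alg F I -> S} := mmap f fmonom_eval.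

Lemma free_eval_gen i : free_eval (free_gen i) = v i.
Proof.
transitivity (f 1 * fmonom_eval (fmu i)); first exact: mmapU.
by rewrite rmorph1 mul1r /fmonom_eval fmU big_seq1.
Qed.

End FreeAlgebra.

Lemma free_evalZ (F : comNzRingType) (I : choiceType) (v : I -> F) k x :
  free_eval idfun v (k *: x) = k * free_eval idfun v x.
Proof. exact: mmapZ. Qed.

Local Notation ord4 k := (@Ordinal 4 k isT).

Section QuantumSL2.
Variables (F : fieldType) (q : F).

Definition SLq_relators (A : algType F) (a b c d : A) : seq A :=
  [:: a * b - q *: (b * a);
      a * c - q *: (c * a);
      b * d - q *: (d * b);
      b * c - c * b;
      c * d - q *: (d * c);
      a * d - d * a - (q - q^-1) *: (b * c);
      a * d - q *: (b * c) - 1].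

Lemma SLq_relators_proper (A : algType F) (a b c d : A)
    (eps : {rmorphism A -> F}) :
  (forall k x, eps (k *: x) = k * eps x) ->
  [/\ eps a = 1, eps b = 0, eps c = 0 & eps d = 1] ->
  ~ in_ideal (SLq_relators a b c d) 1.
Proof.
move=> Z [Ea Eb Ec Ed]; apply: (in_ideal_proper (f := eps)).
rewrite /= !(rmorphB, rmorphM, rmorph1, Z) Ea Eb Ec Ed.
by rewrite !(mul0r, mulr0, mulr1, subr0, subrr) eqxx.
Qed.

Local Notation a := (free_gen F (ord4 0)).
Local Notation b := (free_gen F (ord4 1)).
Local Notation c := (free_gen F (ord4 2)).
Local Notation d := (free_gen F (ord4 3)).

Lemma SLq_proper : ~ in_ideal (SLq_relators a b c d) 1.
Proof.
pose v (i : 'I_4) : F := ((i == ord4 0) || (i == ord4 3))%:R.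
apply: (@SLq_relators_proper _ _ _ _ _ (free_eval idfun v)).
  exact: free_evalZ.
by split; apply: free_eval_gen.
Qed.

(* For q = 0 the convention 0^-1 = 0 makes this a presentation of no interest. *)
Definition SLq_presentation := Presentation SLq_proper.

Definition ASLq : algType F := quot_alg SLq_presentation.

Definition SLq_a : ASLq := quot_pi SLq_presentation a.
Definition SLq_b : ASLq := quot_pi SLq_presentation b.
Definition SLq_c : ASLq := quot_pi SLq_presentation c.
Definition SLq_d : ASLq := quot_pi SLq_presentation d.

End QuantumSL2.

Section ClassicalSL2.
Variable F : fieldType.
(* {mpoly F[4]}, whose notation is taken over by monalg. *)
Local Notation poly4 := (mpoly 4 F).
Local Notation X k := (mpolyX F (mnm1 (ord4 k)) : poly4).

Definition SL2_relators : seq poly4 := [:: X 0 * X 3 - X 1 * X 2 - 1].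

Lemma SL2_proper : ~ in_ideal SL2_relators 1.
Proof.
pose v (i : 'I_4) : F := ((i == ord4 0) || (i == ord4 3))%:R.
apply: (in_ideal_proper (f := meval v)); rewrite /= andbT.
rewrite !(rmorphB, rmorphM, rmorph1) /= !mevalXU /v /=.
by rewrite mul0r mul1r subr0 subrr.
Qed.

Definition SL2_presentation := Presentation SL2_proper.

Definition ASL2 : algType F := quot_alg SL2_presentation.

Definition SL2_alpha : ASL2 := quot_pi SL2_presentation (X 0).
Definition SL2_beta : ASL2 := quot_pi SL2_presentation (X 1).
Definition SL2_gamma : ASL2 := quot_pi SL2_presentation (X 2).
Definition SL2_delta : ASL2 := quot_pi SL2_presentation (X 3).

End ClassicalSL2.

Section FreeModule.
Variables (R : nzRingType) (M : lmodType R).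

Definition is_basis (I : finType) (e : I -> M) : Prop :=
  (forall x : M, exists k : I -> R, x = \sum_i k i *: e i) /\
  (forall k : I -> R, \sum_i k i *: e i = 0 -> forall i, k i = 0).

Definition free_of_rank (n : nat) : Prop := exists e : 'I_n -> M, is_basis e.

End FreeModule.

(* Carriers of S seen as a module over R through phi; see left_module and
   right_module below. *)
Definition left_carrier (R S : nzRingType) (phi : {rmorphism R -> S}) : Type :=
  S.
Definition right_carrier (R S : nzRingType) (phi : {rmorphism R -> S}) : Type :=
  S.

Section RestrictionOfScalars.
Variables (R S : nzRingType) (phi : {rmorphism R -> S}).

HB.instance Definition _ := GRing.Zmodule.on (left_carrier phi).
HB.instance Definition _ := GRing.Zmodule.on (right_carrier phi).

Let lscale (r : R) (x : left_carrier phi) : left_carrier phi := phi r * (x : S).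
Let rscale (r : R^c) (x : right_carrier phi) : right_carrier phi :=
  (x : S) * phi (r : R).

Let lscaleA r s x : lscale r (lscale s x) = lscale (r * s) x.
Proof. by rewrite /lscale rmorphM mulrA. Qed.
Let lscale1 : left_id 1 lscale.
Proof. by move=> x; rewrite /lscale rmorph1 mul1r. Qed.
Let lscaleDr : right_distributive lscale +%R.
Proof. by move=> r x y; apply: mulrDr. Qed.
Let lscaleDl x : {morph lscale^~ x : r s / r + s}.
Proof. by move=> r s; rewrite /lscale rmorphD; apply: mulrDl. Qed.
HB.instance Definition _ := GRing.Zmodule_isLmodule.Build R (left_carrier phi)
  lscaleA lscale1 lscaleDr lscaleDl.

Let rscaleA r s x : rscale r (rscale s x) = rscale (r * s) x.
Proof. by rewrite /rscale -mulrA; congr (_ * _); apply/esym/(rmorphM phi). Qed.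
Let rscale1 : left_id 1 rscale.
Proof. by move=> x; rewrite /rscale (rmorph1 phi) mulr1. Qed.
Let rscaleDr : right_distributive rscale +%R.
Proof. by move=> r x y; apply: mulrDl. Qed.
Let rscaleDl x : {morph rscale^~ x : r s / r + s}.
Proof. by move=> r s; rewrite /rscale (rmorphD phi); apply: mulrDr. Qed.
HB.instance Definition _ := GRing.Zmodule_isLmodule.Build R^c (right_carrier phi)
  rscaleA rscale1 rscaleDr rscaleDl.

Definition left_module : lmodType R := left_carrier phi.

(* A right R-module is encoded as a left module over the converse ring R^c. *)
Definition right_module : lmodType R^c := right_carrier phi.

Lemma left_moduleE (r : R) (x : left_module) : r *: x = phi r * (x : S) :> S.
Proof. by []. Qed.

Lemma right_moduleE (r : R^c) (x : right_module) :
  r *: x = (x : S) * phi (r : R) :> S.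
Proof. by []. Qed.

End RestrictionOfScalars.

Definition range_mns (l : nat) (x : 'I_l * 'I_l * 'I_l) : bool :=
  let: (m, n, s) := x in
  [&& 1 <= m <= l - 1, 0 <= n <= l - 1 & m <= s <= l - 1]%N.

Definition range_nsr (l : nat) (x : 'I_l * 'I_l * 'I_l) : bool :=
  let: (n, s, r) := x in
  [&& 0 <= n <= l - 1, 0 <= r <= l - 1 & 0 <= s <= l - r - 1]%N.

(* a^m b^n c^s on the left summand, b^n c^s d^r on the right one. *)
Definition SLq_monomial (F : fieldType) (q : F) (l : nat)
    (x : {x | @range_mns l x} + {x | @range_nsr l x}) : ASLq q :=
  match x with
  | inl y => let: (m, n, s) := val y in
             SLq_a q ^+ m * SLq_b q ^+ n * SLq_c q ^+ s
  | inr y => let: (n, s, r) := val y in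
             SLq_b q ^+ n * SLq_c q ^+ s * SLq_d q ^+ r
  end.

(* Main.v *)
Require Import Defs.
From HB Require Import structures.
From mathcomp Require Import all_boot all_order all_algebra.
From mathcomp Require Import boolp reals complex.
From mathcomp Require Import zify ring mpoly.
From mathcomp Require finmap monalg.

Set Implicit Arguments.
Unset Strict Implicit.
Unset Printing Implicit Defensive.

Import GRing.Theory.
Local Open Scope ring_scope.

(** Write A for the quantum group and B for the classical coordinate ring.  In
    both cases of the hypothesis q^2 has order l and q^l = -(-1)^l, and only
    these two facts are used; everything holds over any field.

    The map B -> A exists because the l-th powers of the generators commute
    pairwise and a^l d^l = 1 + b^l c^l.  Indeed a^k d^k is the polynomial
    prod_(j < k) (1 + q^(2j+1) X) evaluated at X = bc [SLq_rels_expr_ad], and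
    this polynomial is 1 + X^l when k = l [SLq_poch_root].

    Spanning [SLq_span].  A is spanned over the field by the monomials
    a^i b^j c^k and b^j c^k d^r [PBW_generate].  Modulo l-th powers one may take
    every exponent below l, which leaves more monomials than the theorem lists:
    a^m b^n c^s with s < m is missing, and so is b^n c^s d^r with s >= l - r.
    The first is recovered from the listed b^n c^s d^(l-m): multiplied by a^l it
    becomes, up to a nonzero scalar, a^m (a^(l-m) d^(l-m)) b^n c^s, that is
    a^m b^n c^s plus multiples of monomials a^m b^(n+j) c^(s+j) with j >= 1,
    whose c-exponent is still below l.  Descending induction on s
    concludes.  The second kind is obtained in the same way from d^l and the
    monomials a^m b^n c^s with s >= m.

    Independence [frobenius_span_free].  No triangularity is needed a second
    time, because l^3 is the right number of monomials.  After inverting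
    alpha, the products a^m b^n c^s with all m, n, s < l form a left basis of A,
    since d = a^(-1) (1 + qbc).  Right multiplication is linear for the left
    module structure, so it represents A by matrices of size l^3 over the field
    of fractions K of B [reg_rels], and the first row of these matrices is
    a left B-linear map L from A to K^(l^3) sending the products
    a^m b^n c^s to the standard basis [frobenius_regular].  A family of l^3
    generators of A has images under L that span K^(l^3), hence that are
    independent over K, hence the family is independent over B.  This last
    step needs B to embed in K, which follows from the normal form of the
    elements of B [ASL2_normal_form, coord_inj].

    Right modules.  A monomial e moves across the image of B up to signs:
    e phi(k) = phi(tau k) e, where tau is an automorphism of B that depends on e
    [SLq_twists].  So a left basis made of monomials is also a right basis
    [twists_right_basis]. *)

(** * Morphisms out of presented algebras *)

Lemma quot_lift (F : comNzRingType) (A : algType F) (P : presentation A)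
    (S : nzRingType) (g : {rmorphism A -> S}) :
  all (fun u => g u == 0) P ->
  exists h : {rmorphism quot_alg P -> S}, forall x, h (quot_pi P x) = g x.
Proof.
move=> /allP g0.
have gI u : in_ideal P u -> g u = 0.
  elim=> [|x v y z /g0/eqP gv _ gz]; first exact: rmorph0.
  by rewrite rmorphD !rmorphM /= gv gz mulr0 mul0r addr0.
pose h x := g (sval (cid (quot_pi_surj (P := P) x))).
have hpi x : h (quot_pi P x) = g x.
  rewrite /h; case: cid => y /= /quot_piP/gI/eqP.
  by rewrite rmorphB subr_eq0 => /eqP.
have hW (T : quot_alg P -> Prop) : (forall x, T (quot_pi P x)) -> forall x, T x.
  by move=> Tpi x; have [y <-] := quot_pi_surj x.
have hB : zmod_morphism h.
  elim/hW=> x; elim/hW=> y.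
  by rewrite -rmorphB !hpi rmorphB.
have hM : monoid_morphism h.
  split; first by rewrite -(rmorph1 (quot_pi P)) hpi rmorph1.
  elim/hW=> x; elim/hW=> y.
  by rewrite -rmorphM !hpi rmorphM.
pose h' := HB.pack_for {rmorphism quot_alg P -> S} h
  (GRing.isZmodMorphism.Build _ _ h hB) (GRing.isMonoidMorphism.Build _ _ h hM).
by exists h'.
Qed.

(** Compatibility with scalars for an arbitrary scaling s, so that it applies
    to maps into algebras over another field. *)
Lemma quot_liftZ (F : comNzRingType) (A : algType F) (P : presentation A)
    (S : Type) (s : F -> S -> S) (g : A -> S) (h : quot_alg P -> S) :
  (forall x, h (quot_pi P x) = g x) -> (forall k x, g (k *: x) = s k (g x)) ->
  forall k x, h (k *: x) = s k (h x).
Proof.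
move=> hg gZ k x; have [y <-] := quot_pi_surj x.
by rewrite -linearZ !hg gZ.
Qed.

Lemma quot_pi_relators (F : comNzRingType) (A : algType F) (P : presentation A) u :
  u \in relators P -> quot_pi P u = 0.
Proof.
move=> Pu; rewrite -(rmorph0 (quot_pi P)).
by apply/quot_piP/idealP; rewrite subr0; apply: ideal_relator.
Qed.

Section FreeAlgebra.
Import finmap monalg.

(** The target is not commutative: only the scalars have to be central. *)
Lemma free_lift (F : comNzRingType) (I : choiceType) (S : nzRingType)
    (f : {rmorphism F -> S}) (v : I -> S) :
  (forall k s, GRing.comm (f k) s) ->
  exists g : {rmorphism free_alg F I -> S},
    (forall i, g (free_gen F i) = v i) /\
    (forall k x, g (k *: x) = f k * g x).
Proof.
move=> fC.
pose h (m : {fmonom I}) : S := \prod_(i <- m : seq I) v i.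
have hM : mmorphism h.
  by split=> [x y|]; rewrite /h ?fmM ?fm1 ?big_cat ?big_nil.
pose h' := HB.pack_for (MMorphism.type {fmonom I} S) h
  (monalg.isMultiplicative.Build {fmonom I} S h hM).
pose g : free_alg F I -> S := mmap f h'.
have gB : zmod_morphism g by move=> x y; apply: mmapB.
have gM : monoid_morphism g.
  have [|gM g1] := commr_mmap_is_multiplicative (f := f) (h := h').
    by move=> x m m'; apply: fC.
  by split.
exists (HB.pack_for {rmorphism free_alg F I -> S} g
  (GRing.isZmodMorphism.Build _ _ g gB) (GRing.isMonoidMorphism.Build _ _ g gM)).
split=> [i|k x]; last exact: mmapZ.
transitivity (f 1 * h (fmu i)); first exact: mmapU.
by rewrite rmorph1 mul1r /h fmU big_seq1.
Qed.

Lemma free_alg_ind (F : comNzRingType) (I : choiceType)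
    (P : free_alg F I -> Prop) :
  P 1 -> (forall x y, P x -> P y -> P (x + y)) ->
  (forall k x, P x -> P (k *: x)) ->
  (forall i x, P x -> P (free_gen F i * x)) -> forall x, P x.
Proof.
move=> P1 PD PZ PM x.
have P0 : P 0 by rewrite -(scale0r 1); apply: PZ.
have PU (m : {fmonom I}) : P (<< m >>).
  case: m => s; elim: s => [|i s IH].
    by move: P1; congr P; congr << _ >>; apply/eqP; rewrite fmP fm1.
  have -> : << FMonom (i :: s) >> = free_gen F i * << FMonom s >> :> free_alg F I.
    transitivity (<< mmul (fmu i) (FMonom s) >> : free_alg F I).
      by congr << _ >>; apply/eqP; rewrite fmP fmM fmU.
    rewrite /free_gen; apply/esym.
    by apply: etrans (fgmulUU _ _ _ _) _; rewrite mulr1.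
  exact: PM.
have -> : x = \sum_(m <- monalg.msupp x) monalg.mcoeff m x *: (<< m >> : free_alg F I).
  rewrite [LHS]monalgE; apply: eq_bigr => m _.
  by apply/malgP=> m'; rewrite monalg.mcoeffZ !mcoeffU mulrnAr mulr1.
by elim/big_ind: _ => // m _; apply: PZ.
Qed.

End FreeAlgebra.

(** Monomials are multiplicative as soon as the images of the variables commute
    with each other; they need not be central. *)
Lemma mmap1_commM n (S : nzRingType) (h : 'I_n -> S) (m1 m2 : 'X_{1..n}) :
  (forall i j, GRing.comm (h i) (h j)) ->
  mmap1 h (m1 + m2)%MM = mmap1 h m1 * mmap1 h m2.
Proof.
move=> hC; rewrite /mmap1.
suff [] : \prod_(i < n) h i ^+ (m1 + m2)%MM i =
  (\prod_(i < n) h i ^+ m1 i) * \prod_(i < n) h i ^+ m2 i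
  /\ forall j, GRing.comm (h j) (\prod_(i < n) h i ^+ m1 i) by [].
elim/big_rec3: _ => [|i y1 y2 y3 _ [-> y2C]].
  by split=> [|j]; rewrite ?mulr1; last exact: commr1.
split=> [|j]; last by apply: commrM; [apply: commrX|].
have /commr_sym yC : GRing.comm y2 (h i ^+ m2 i) by apply/commrX/commr_sym.
by rewrite mnmDE exprD -!mulrA; congr (_ * _); rewrite !mulrA yC.
Qed.

Lemma mpoly_lift n (F : comNzRingType) (A : algType F) (v : 'I_n -> A) :
  (forall i j, GRing.comm (v i) (v j)) ->
  exists g : {rmorphism mpoly n F -> A},
    (forall i, g (mpolyX F (mnm1 i)) = v i) /\
    (forall k x, g (k *: x) = k *: g x).
Proof.
move=> vC; pose g : mpoly n F -> A := mpoly.mmap (in_alg A) v.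
have gZ k x : g (k *: x) = k *: g x.
  by rewrite /g mpoly.mmapZ /= mulr_algl.
have gX m : g (mpolyX F m) = mmap1 v m by apply: mpoly.mmapX.
have gB : zmod_morphism g by move=> x y; apply: mpoly.mmapB.
have gD x y : g (x + y) = g x + g y by apply: mpoly.mmapD.
have g0 : g 0 = 0 by apply: mpoly.mmap0.
have gM : monoid_morphism g.
  split; first by rewrite /g -mpolyX0 [LHS]gX mmap11.
  move=> x y; elim/mpolyind: x => [|c m x _ _ IH].
    by rewrite mul0r g0 mul0r.
  rewrite mulrDl !gD mulrDl IH; congr (_ + _).
  elim/mpolyind: y {IH} => [|c' m' y _ _ IH].
    by rewrite mulr0 g0 mulr0.
  rewrite mulrDr !gD mulrDr IH; congr (_ + _).
  rewrite -scalerAl -scalerAr -mpolyXD !gZ !gX mmap1_commM //.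
  by rewrite -scalerAl -scalerAr.
exists (HB.pack_for {rmorphism mpoly n F -> A} g
  (GRing.isZmodMorphism.Build _ _ g gB) (GRing.isMonoidMorphism.Build _ _ g gM)).
by split=> // i; rewrite [LHS]gX mmap1U.
Qed.

Lemma mpoly_gen_ind n (F : comNzRingType) (P : mpoly n F -> Prop) :
  P 1 -> (forall x y, P x -> P y -> P (x + y)) ->
  (forall k x, P x -> P (k *: x)) ->
  (forall i x, P x -> P (mpolyX F (mnm1 i) * x)) -> forall x, P x.
Proof.
move=> P1 PD PZ PM x.
have P0 : P 0 by rewrite -(scale0r 1); apply: PZ.
elim/mpolyind: x => // c m x _ _; apply: PD; apply: PZ.
rewrite mpolyXE_id.
suff : forall s (y : mpoly n F), P y ->
    P (\prod_(i <- s) mpolyX F (mnm1 i) ^+ m i * y).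
  by move=> /(_ (index_enum _) 1 P1); rewrite mulr1.
elim=> [|i s IH] y Py; first by rewrite big_nil mul1r.
rewrite big_cons -mulrA; move: (m i) => k.
elim: k => [|k IHk]; first by rewrite expr0 mul1r; apply: IH.
by rewrite exprS -mulrA; apply: PM.
Qed.

(** * Skew-commuting elements *)
Section QCommuting.
Variables (F : comNzRingType) (A : algType F).

Lemma qcommX (u : F) (x y : A) (i j : nat) :
  x * y = u *: (y * x) ->
  x ^+ i * y ^+ j = u ^+ (i * j) *: (y ^+ j * x ^+ i).
Proof.
move=> xy.
have xyj k : x * y ^+ k = u ^+ k *: (y ^+ k * x).
  elim: k => [|k IH]; first by rewrite !expr0 mulr1 mul1r scale1r.
  rewrite [y ^+ k.+1]exprS mulrA xy -scalerAl -(mulrA y x) IH -scalerAr.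
  by rewrite scalerA mulrA -!exprS.
elim: i => [|i IH]; first by rewrite mul0n !expr0 mulr1 mul1r scale1r.
rewrite [x ^+ i.+1]exprSr -mulrA xyj -scalerAr (mulrA (x ^+ i)) IH -scalerAl scalerA.
by rewrite -mulrA -exprD -exprSr mulSn.
Qed.

Lemma qcommXl (u : F) (x y : A) (i : nat) :
  x * y = u *: (y * x) -> x ^+ i * y = u ^+ i *: (y * x ^+ i).
Proof. by move=> xy; rewrite -[y in LHS]expr1 (qcommX _ _ xy) muln1 expr1. Qed.

Lemma qcommXr (u : F) (x y : A) (j : nat) :
  x * y = u *: (y * x) -> x * y ^+ j = u ^+ j *: (y ^+ j * x).
Proof. by move=> xy; rewrite -[x in LHS]expr1 (qcommX _ _ xy) mul1n expr1. Qed.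

Lemma qcommM (u v : F) (x y z : A) :
  x * y = u *: (y * x) -> x * z = v *: (z * x) ->
  x * (y * z) = (u * v) *: (y * z * x).
Proof.
move=> xy xz; rewrite (mulrA x) xy -scalerAl -(mulrA y x) xz -scalerAr scalerA.
by rewrite mulrA.
Qed.

End QCommuting.

Lemma qcommV (F : fieldType) (A : algType F) (u : F) (x y : A) :
  u != 0 -> x * y = u *: (y * x) -> y * x = u^-1 *: (x * y).
Proof. by move=> u0 ->; rewrite scalerA mulVf // scale1r. Qed.

(** * The defining relations *)

(** The q-shifted factorial (-qX; q^2)_k: it is to a^k d^k what 1 + qbc is to
    ad. *)
Definition SLq_poch (F : fieldType) (q : F) k : {poly F} :=
  \prod_(j < k) (1 + q ^+ j.*2.+1 *: 'X).
Section Relations.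
Variables (F : fieldType) (q : F) (A : algType F) (a b c d : A).

Definition SLq_rels := all (eq_op^~ 0) (SLq_relators q a b c d).

Lemma SLq_relsP :
  SLq_rels <->
  [/\ a * b = q *: (b * a), a * c = q *: (c * a), b * d = q *: (d * b),
      b * c = c * b &
      [/\ c * d = q *: (d * c), a * d = 1 + q *: (b * c)
        & d * a = 1 + q^-1 *: (b * c)]].
Proof.
rewrite /SLq_rels /= !subr_eq0; split.
  move=> /and5P[/eqP ab /eqP ac /eqP bd /eqP bc /and4P[/eqP cd /eqP ad1 ad2 _]].
  have {}ad2 : a * d = 1 + q *: (b * c) by apply/eqP; rewrite -subr_eq.
  split=> //; split=> //.
  rewrite -[LHS](subKr (a * d)) ad1 ad2 scalerBl opprB -addrA.
  by rewrite [X in _ + X]addrC subrK.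
case=> -> -> -> -> [-> ad da]; rewrite !eqxx ad da /= opprD addrACA subrr add0r.
by rewrite -scalerBl eqxx addrK eqxx.
Qed.

(** Passing from k to k+1 inserts ad = 1 + qbc in the middle of a^k d^k, and
    moving bc to the right of d^k multiplies it by q^(2k). *)
Lemma SLq_rels_expr_ad k : SLq_rels ->
  a ^+ k * d ^+ k = horner_alg (b * c) (SLq_poch q k).
Proof.
case/SLq_relsP=> _ _ bd _ [cd ad _].
rewrite /SLq_poch; elim: k => [|k IH].
  by rewrite big_ord0 rmorph1 !expr0 mulr1.
rewrite big_ord_recr rmorphM /= -IH exprSr exprS mulrA -(mulrA _ a d) ad.
rewrite mulrDr mulr1 mulrDl -scalerAr -scalerAl -(mulrA _ _ (d ^+ k)).
rewrite -(mulrA b) (qcommXr k cd) -scalerAr (mulrA b) (qcommXr k bd).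
rewrite rmorphD rmorph1 -mul_polyC rmorphM /= horner_algC horner_algX mulr_algl.
rewrite mulrDr mulr1; congr (_ + _).
rewrite -scalerAl -!scalerAr !scalerA !mulrA; congr (_ *: _).
by rewrite -exprS -exprD addSn addnn.
Qed.
End Relations.

(** Exchanging a and d inverts q: every statement about a^k d^k gives one about
    d^k a^k. *)
Lemma SLq_rels_sym (F : fieldType) (q : F) (A : algType F) (a b c d : A) :
  q != 0 -> SLq_rels q a b c d -> SLq_rels q^-1 d b c a.
Proof.
move=> q0 /SLq_relsP[ab ac bd bc [cd ad da]]; apply/SLq_relsP.
by split=> //; [apply: qcommV|apply: qcommV|apply: qcommV|split=> //;
  [apply: qcommV|rewrite invrK]].
Qed.

(** * The parameter at a root of unity *)
Section RootOfUnity.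
Variables (F : fieldType) (q : F) (l : nat).
Hypotheses (l_gt0 : (0 < l)%N) (q2l : l.-primitive_root (q ^+ 2)).
Hypothesis ql : q ^+ l = - (-1) ^+ l.

Lemma SLq_root_neq0 : q != 0.
Proof.
apply/eqP=> q0; have := ql; rewrite q0 expr0n gtn_eqF //= => /eqP.
by rewrite eq_sym oppr_eq0 signr_eq0.
Qed.
Let q0 := SLq_root_neq0.

Lemma SLq_root_sqr : q ^+ l * q ^+ l = 1.
Proof. by rewrite ql mulrNN -exprD addnn -mul2n exprM sqrrN expr1n expr1n. Qed.

Lemma SLq_root_inv : q^-1 ^+ l = q ^+ l.
Proof.
rewrite exprVn; apply: (mulfI (expf_neq0 l q0)).
by rewrite mulfV ?expf_neq0 // SLq_root_sqr.
Qed.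

Lemma SLq_root_expXX : q ^+ (l * l) = 1.
Proof.
rewrite exprM ql; have [lo|le] := boolP (odd l).
  by rewrite -signr_odd lo expr1 opprK expr1n.
by rewrite -signr_odd (negbTE le) expr0 -signr_odd (negbTE le).
Qed.

Lemma SLq_root_prim_inv : l.-primitive_root (q^-1 ^+ 2).
Proof.
have -> : q^-1 ^+ 2 = (q ^+ 2) ^+ l.-1.
  apply: (mulIf (expf_neq0 2 q0)); rewrite -exprSr prednK //.
  by rewrite -exprMn mulVf // expr1n (prim_expr_order q2l).
by rewrite (prim_root_exp_coprime _ q2l) coprime_sym coprimenP.
Qed.

(** The roots of the left side are the -q^(-1) z^j with z = q^(-2) a primitive
    l-th root of unity, so that it is X^l - 1 evaluated at -qX, up to a scalar
    that q^(l*l) = 1 and (-q)^l = -1 determine. *)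
Lemma SLq_poch_root : SLq_poch q l = 1 + 'X^l.
Proof.
have qNl : (- q) ^+ l = -1.
  by rewrite exprNn ql mulrN -exprD addnn -mul2n exprM sqrrN expr1n expr1n.
have qN0 : - q != 0 by rewrite oppr_eq0.
pose z := q^-1 ^+ 2; pose u : {poly F} := - q *: 'X.
have -> : SLq_poch q l =
    \prod_(j < l) ((q ^+ j.*2.+1 / - q)%:P * (('X - (z ^+ j)%:P) \Po u)).
  apply: eq_bigr => j _; rewrite comp_polyB comp_polyX comp_polyC mulrBr -rmorphM.
  rewrite mul_polyC scalerA divfK // addrC; congr (_ + _).
  rewrite -polyC1 -polyCN; congr (_%:P).
  rewrite /z -exprM mul2n exprS invrN mulrN mulNr opprK.
  by rewrite [q * _]mulrC mulfK // -exprMn mulfV // expr1n.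
rewrite big_split /= -rmorph_prod -(rmorph_prod (comp_poly u)) /=.
have -> : \prod_(j < l) ('X - (z ^+ j)%:P) = 'X^l - 1.
  by rewrite -(factor_Xn_sub_1 SLq_root_prim_inv) big_mkord; apply: eq_bigr.
have -> : \prod_(j < l) (q ^+ j.*2.+1 / - q) = -1.
  rewrite big_split /= prodr_const card_ord exprVn qNl invrN invr1.
  have -> : \prod_(j < l) q ^+ j.*2.+1 = 1.
    apply: etrans SLq_root_expXX.
    elim: (l) => [|k IH]; first by rewrite big_ord0.
    by rewrite big_ord_recr /= IH -exprD; congr (q ^+ _); lia.
  by rewrite mul1r.
rewrite comp_polyB comp_Xn_poly comp_polyC exprZn qNl scaleN1r polyCN mulN1r.
by rewrite opprB opprK.
Qed.

End RootOfUnity.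

(** * Linear subspaces as predicates *)
Section Subspace.
Variables (F : fieldType) (A : algType F).

Definition subspace (M : A -> Prop) :=
  M 0 /\ forall k x y, M x -> M y -> M (k *: x + y).

Variable M : A -> Prop.
Hypothesis Msub : subspace M.

Lemma subspaceD x y : M x -> M y -> M (x + y).
Proof. by move=> Mx My; rewrite -[x]scale1r; apply Msub. Qed.

Lemma subspaceZ k x : M x -> M (k *: x).
Proof. by move=> Mx; rewrite -[_ *: _]addr0; apply: Msub.2 => //; apply Msub. Qed.

Lemma subspaceZK k x : k != 0 -> M (k *: x) -> M x.
Proof. by move=> k0 /(subspaceZ k^-1); rewrite scalerA mulVf // scale1r. Qed.

Lemma subspace_sum (I : finType) (P : pred I) (f : I -> A) :
  (forall i, P i -> M (f i)) -> M (\sum_(i | P i) f i).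
Proof.
by move=> Mf; elim/big_ind: _ => //; [apply Msub|apply: subspaceD].
Qed.

(** The form of triangularity used for spanning: if all terms of a
    combination but the first are known to be in M, so is the first. *)
Lemma subspace_lead n (p : nat -> F) (y : nat -> A) : p 0 != 0 ->
  M (\sum_(j < n.+1) p j *: y j) -> (forall j, (0 < j <= n)%N -> M (y j)) ->
  M (y 0).
Proof.
move=> p0 Msum My; apply: (subspaceZK p0).
set S := \sum_(j < n.+1) _ in Msum.
have -> : p 0 *: y 0 = (-1) *: (\sum_(j < n) p j.+1 *: y j.+1) + S.
  by rewrite /S big_ord_recl scaleN1r addrCA [X in _ + X]addrC subrr addr0.
apply: Msub.2 => //; apply: subspace_sum => j _.
by apply/subspaceZ/My; rewrite /= ltn_ord.
Qed.

Lemma subspace_exprl z x k : (forall x, M x -> M (z * x)) -> M x ->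
  M (z ^+ k * x).
Proof.
by move=> Mz Mx; elim: k => [|k IH]; rewrite ?mul1r // exprS -mulrA; apply: Mz.
Qed.

End Subspace.

(** * The monomials spanning the algebra *)
Section PBW.
Variables (F : fieldType) (q : F) (A : algType F) (a b c d : A).
Hypothesis q0 : q != 0.
Hypothesis rel : SLq_rels q a b c d.

(** Generation by a, b, c, d, as an induction principle: words are built by
    multiplying on the left. *)
Definition generate :=
  forall M : A -> Prop, subspace M -> M 1 ->
    (forall x, M x -> [/\ M (a * x), M (b * x), M (c * x) & M (d * x)]) ->
  forall x, M x.

(** The linear span, as the intersection of all subspaces that contain the
    monomials. *)
Definition PBW_span (x : A) :=
  forall M : A -> Prop, subspace M ->
    (forall i j k, M (a ^+ i * b ^+ j * c ^+ k)) ->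
    (forall j k r, M (b ^+ j * c ^+ k * d ^+ r)) -> M x.

Let bcX i j : GRing.comm (b ^+ i) (c ^+ j).
Proof.
have [_ _ _ bc _] := (SLq_relsP _ _ _ _ _).1 rel.
by apply/commrX/commr_sym/commrX/commr_sym.
Qed.

Lemma SLq_bcM i j k r :
  b ^+ i * c ^+ j * (b ^+ k * c ^+ r) = b ^+ (i + k) * c ^+ (j + r).
Proof.
rewrite mulrA -(mulrA (b ^+ i)) -bcX mulrA -exprD -mulrA.
by rewrite -exprD.
Qed.

Lemma SLq_bcd n s r :
  b ^+ n * c ^+ s * d ^+ r = q ^+ ((n + s) * r) *: (d ^+ r * (b ^+ n * c ^+ s)).
Proof.
have [_ _ bd _ [cd _ _]] := (SLq_relsP _ _ _ _ _).1 rel.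
rewrite -mulrA (qcommX _ _ cd) -scalerAr !mulrA (qcommX _ _ bd).
by rewrite -scalerAl scalerA -exprD addnC mulnDl.
Qed.

Lemma SLq_abc i n s :
  a ^+ i * (b ^+ n * c ^+ s) = q ^+ (i * (n + s)) *: (b ^+ n * c ^+ s * a ^+ i).
Proof.
have [ab ac _ _ _] := (SLq_relsP _ _ _ _ _).1 rel.
by rewrite (qcommM (qcommX i n ab) (qcommX i s ac)) -exprD mulnDr.
Qed.

(** The span of the monomials is stable under left multiplication by the
    generators.  Stability under b and c comes first: the products ad and da
    that arise for a and d are rewritten with bc. *)
Lemma PBW_generate : generate -> forall x, PBW_span x.
Proof.
have [ab ac bd bc [cd ad da]] := (SLq_relsP _ _ _ _ _).1 rel.
have Nsub : subspace PBW_span.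
  split=> [|k x y Nx Ny] M Msub M1 M2; first exact: Msub.1.
  by apply: Msub.2; [apply: Nx|apply: Ny].
have N1 i j k : PBW_span (a ^+ i * b ^+ j * c ^+ k) by move=> M _ M1 _.
have N2 j k r : PBW_span (b ^+ j * c ^+ k * d ^+ r) by move=> M _ _ M2.
have NM y : (forall i j k, PBW_span (y * (a ^+ i * b ^+ j * c ^+ k))) ->
    (forall j k r, PBW_span (y * (b ^+ j * c ^+ k * d ^+ r))) ->
    forall x, PBW_span x -> PBW_span (y * x).
  move=> y1 y2 x Nx; apply: (Nx (fun x => PBW_span (y * x))) => //.
  split; first by rewrite mulr0; apply: Nsub.1.
  by move=> k u v yu yv; rewrite mulrDr -scalerAr; apply: Nsub.2.
have qX i : q ^+ i != 0 by apply: expf_neq0.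
have Nb : forall x, PBW_span x -> PBW_span (b * x).
  apply: NM => [i j k|j k r]; last by rewrite !mulrA -exprS.
  rewrite !mulrA (qcommV (qX i) (qcommXl i ab)) -!scalerAl.
  by rewrite -(mulrA (a ^+ i)) -exprS; apply: (subspaceZ Nsub).
have Nc : forall x, PBW_span x -> PBW_span (c * x).
  apply: NM => [i j k|j k r]; rewrite !mulrA.
    rewrite (qcommV (qX i) (qcommXl i ac)) -!scalerAl -(mulrA (a ^+ i)).
    by rewrite -{1}[c]expr1 -bcX expr1 -!mulrA -exprS !mulrA; apply: (subspaceZ Nsub).
  by rewrite -{1}[c]expr1 -bcX expr1 -(mulrA (b ^+ j)) -exprS.
move=> gen; apply: (gen _ Nsub); first by move: (N1 0%N 0%N 0%N); rewrite !mulr1.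
move=> x Nx; split; [|exact: Nb|exact: Nc|]; move: x Nx; apply: NM.
- by move=> i j k; rewrite !mulrA -exprS.
- move=> j k [|r]; first by rewrite mulr1 mulrA -[a]expr1.
  rewrite mulrA -{1}[a]expr1 SLq_abc -scalerAl expr1 exprS; apply: (subspaceZ Nsub) => //.
  rewrite -(mulrA _ a) (mulrA a) ad mulrDl mulrDr mul1r addrC -scalerAl -scalerAr.
  apply: Nsub.2 => //; rewrite mulrA -(expr1 b) -(expr1 c) SLq_bcM.
  by rewrite !addn1; apply: N2.
- move=> [|i] j k.
    rewrite mul1r -{1}[d]expr1.
    rewrite -[_ * _](scalerK (qX ((j + k) * 1)%N)).
    by apply: (subspaceZ Nsub) => //; rewrite -SLq_bcd.
  rewrite exprS -!mulrA (mulrA d) da mulrDl mul1r addrC -scalerAl -mulrA.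
  apply: Nsub.2; last by rewrite mulrA.
  by apply: Nb; apply: Nc; rewrite mulrA.
move=> j k r; rewrite mulrA -{1}[d]expr1.
rewrite -[_ * _ * _](scalerK (qX ((j + k) * 1)%N)); apply: (subspaceZ Nsub) => //.
by rewrite scalerAl -SLq_bcd -(mulrA (_ * _)) -exprD.
Qed.

End PBW.

Lemma size_SLq_poch (F : fieldType) (q : F) k : (size (SLq_poch q k) <= k.+1)%N.
Proof.
rewrite /SLq_poch; elim: k => [|k IH]; first by rewrite big_ord0 size_poly1.
rewrite big_ord_recr /=; apply: leq_trans (size_polyMleq _ _) _.
have s2 : (size (1 + q ^+ k.*2.+1 *: 'X)%R <= 2)%N.
  apply: leq_trans (size_polyD _ _) _; rewrite size_poly1 geq_max /=.
  by apply: leq_trans (size_scale_leq _ _) _; rewrite size_polyX.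
by move: (leq_add IH s2); case: (_ + _)%N => //= n; rewrite addn2.
Qed.

Lemma SLq_poch0 (F : fieldType) (q : F) k : (SLq_poch q k)`_0 = 1.
Proof.
rewrite -horner_coef0 /SLq_poch horner_prod big1 // => j _.
by rewrite hornerD hornerZ hornerX mulr0 addr0 hornerC.
Qed.

Section AdSum.
Variables (F : fieldType) (q : F) (A : algType F) (a b c d : A).
Hypothesis rel : SLq_rels q a b c d.

(** The constant coefficient is 1 [SLq_poch0] and no power of bc beyond the
    k-th occurs: the second fact keeps the c-exponents small in the induction
    below. *)
Lemma SLq_ad_sum k x :
  a ^+ k * d ^+ k * x = \sum_(j < k.+1) (SLq_poch q k)`_j *: (b ^+ j * c ^+ j * x).
Proof.
have [_ _ _ bc _] := (SLq_relsP _ _ _ _ _).1 rel.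
rewrite (SLq_rels_expr_ad k rel) /horner_alg /horner_morph.
rewrite (horner_coef_wide _ (_ : _ <= k.+1)%N); last first.
  exact: leq_trans (size_poly _ _) (size_SLq_poch q k).
rewrite mulr_suml; apply: eq_bigr => j _.
by rewrite coef_map /= mulr_algl -scalerAl exprMn_comm.
Qed.

End AdSum.

(** * Spanning over the l-th powers *)
Section Spanning.
Variables (F : fieldType) (q : F) (A : algType F) (a b c d : A).
Hypothesis q0 : q != 0.
Hypothesis rel : SLq_rels q a b c d.
Variables (l : nat) (M : A -> Prop).
Hypothesis l_gt0 : (0 < l)%N.
Hypothesis Msub : subspace M.
Hypothesis Ma : forall x, M x -> M (a ^+ l * x).
Hypothesis Mb : forall x, M x -> M (b ^+ l * x).
Hypothesis Mc : forall x, M x -> M (c ^+ l * x).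
Hypothesis Md : forall x, M x -> M (d ^+ l * x).

Let qX i : q ^+ i != 0. Proof. by apply: expf_neq0. Qed.

Let abc_wrap m n s : M (a ^+ m * b ^+ (n %% l) * c ^+ (s %% l)) ->
  M (a ^+ m * b ^+ n * c ^+ s).
Proof.
move=> H; rewrite [n in b ^+ n](divn_eq n l) [s in c ^+ s](divn_eq s l).
rewrite -mulrA -(SLq_bcM rel) mulrA (SLq_abc rel) -scalerAl.
apply: (subspaceZ Msub); rewrite -!mulrA !(mulnC _ l) !exprM.
apply: (subspace_exprl _ Mb); apply: (subspace_exprl _ Mc).
by rewrite mulrA.
Qed.

Let bcd_wrap n s r : M (b ^+ (n %% l) * c ^+ (s %% l) * d ^+ r) ->
  M (b ^+ n * c ^+ s * d ^+ r).
Proof.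
move=> H; rewrite [n in b ^+ n](divn_eq n l) [s in c ^+ s](divn_eq s l).
rewrite -(SLq_bcM rel) -!mulrA !(mulnC _ l) !exprM.
apply: (subspace_exprl _ Mb); apply: (subspace_exprl _ Mc).
by rewrite mulrA.
Qed.

Hypothesis Mabc : forall m n s, (0 < m < l)%N -> (n < l)%N -> (m <= s < l)%N ->
  M (a ^+ m * b ^+ n * c ^+ s).
Hypothesis Mbcd : forall n s r, (n < l)%N -> (r < l)%N -> (s + r < l)%N ->
  M (b ^+ n * c ^+ s * d ^+ r).

Let bcd_low n s r : (s + r < l)%N -> M (b ^+ n * c ^+ s * d ^+ r).
Proof.
move=> sr; apply: bcd_wrap; rewrite (@modn_small s l); last by lia.
by apply: Mbcd; rewrite ?ltn_mod //; lia.
Qed.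

Let abc_high m n s : (0 < m < l)%N -> (m <= s < l)%N ->
  M (a ^+ m * b ^+ n * c ^+ s).
Proof.
move=> ml ms; apply: abc_wrap; rewrite (@modn_small s l); last by lia.
by apply: Mabc; rewrite ?ltn_mod //; lia.
Qed.

(** From the listed b^n c^s d^(l-m), multiplied by a^l on the left. *)
Let abc_small m n s : (0 < m < l)%N -> (s < l)%N ->
  M (a ^+ m * b ^+ n * c ^+ s).
Proof.
move=> ml; have [k] := ubnP (l - s); elim: k s n => // k IH s n sk sl.
have [ms|sm] := leqP m s; first by apply: abc_high; rewrite ?ms.
have := Ma (@bcd_low n s (l - m) ltac:(lia)).
rewrite (SLq_bcd rel) -scalerAr => /(subspaceZK Msub (qX _)).
rewrite -{1}(subnKC (_ : m <= l)%N); last by lia.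
rewrite exprD -(mulrA (a ^+ m) (a ^+ (l - m))) (mulrA (a ^+ (l - m)) (d ^+ _)).
rewrite (SLq_ad_sum rel) mulr_sumr.
under eq_bigr do rewrite -scalerAr (SLq_bcM rel) mulrA.
move=> /(subspace_lead (y := fun j => a ^+ m * b ^+ (j + n) * c ^+ (j + s)) Msub).
apply; first by rewrite SLq_poch0 oner_neq0.
by move=> j jl; apply: IH; lia.
Qed.

Let abc_all i n s : M (a ^+ i * b ^+ n * c ^+ s).
Proof.
apply: abc_wrap; rewrite [i in a ^+ i](divn_eq i l) mulnC exprD exprM -!mulrA.
apply: (subspace_exprl _ Ma); rewrite mulrA.
have [->|m0] := posnP (i %% l).
  rewrite mul1r -[_ * _]mulr1; apply: (@bcd_low _ _ 0).
  by rewrite addn0 ltn_mod.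
by apply: abc_small; rewrite ?ltn_mod ?m0.
Qed.

(** From the listed a^(l-r) b^n c^s, multiplied by d^l on the left.  The bound
    on s exceeds l because the powers of bc in d^(l-r) a^(l-r) may push the
    c-exponent past l; such exponents wrap around below l - r. *)
Let bcd_small n s r : (s < 2 * l - r)%N -> (r < l)%N ->
  M (b ^+ n * c ^+ s * d ^+ r).
Proof.
have [->|r0] := posnP r; first by rewrite mulr1 -(mul1r (b ^+ n)) => _ _; apply: (abc_all 0).
have [k] := ubnP (2 * l - r - s); elim: k s n => // k IH s n sk sl rl.
have [sr|rs] := ltnP (s + r) l; first exact: bcd_low.
have [ls|sl'] := leqP l s.
  apply: bcd_wrap; apply: bcd_low.
  by rewrite -{1}(subnK ls) modnDr modn_small; lia.
have := Md (@abc_high (l - r) n s ltac:(lia) ltac:(lia)).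
rewrite -{1}(subnKC (ltnW rl)) exprD -(mulrA (a ^+ (l - r))) -(mulrA (d ^+ r)).
rewrite (mulrA (d ^+ (l - r))).
rewrite (SLq_ad_sum (SLq_rels_sym q0 rel)) mulr_sumr.
have dbc i j : d ^+ r * (b ^+ i * c ^+ j) =
    (q ^+ ((i + j) * r))^-1 *: (b ^+ i * c ^+ j * d ^+ r).
  by rewrite (SLq_bcd rel) scalerK.
under eq_bigr do rewrite -scalerAr (SLq_bcM rel) dbc scalerA.
move=> /(subspace_lead
  (p := fun j => (SLq_poch q^-1 (l - r))`_j / q ^+ ((j + n + (j + s)) * r))
  (y := fun j => b ^+ (j + n) * c ^+ (j + s) * d ^+ r) Msub).
apply; first by rewrite SLq_poch0 mul1r invr_eq0.
by move=> j jl; apply: IH; lia.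
Qed.

Lemma SLq_span : generate a b c d -> forall x, M x.
Proof.
move=> gen x; apply: (PBW_generate q0 rel gen) => // [n s r].
rewrite (SLq_bcd rel); apply: (subspaceZ Msub); rewrite (divn_eq r l).
rewrite mulnC exprD exprM -mulrA; apply: (subspace_exprl _ Md).
apply: (subspaceZK Msub (qX ((n + s) * (r %% l))%N)); rewrite -(SLq_bcd rel).
apply: bcd_wrap; apply: bcd_small; rewrite ?ltn_mod //.
by have := ltn_pmod s l_gt0; have := ltn_pmod r l_gt0; lia.
Qed.
End Spanning.

(** * Relations between l-th powers *)
Section RootRelations.
Variables (F : fieldType) (q : F) (l : nat).
Hypotheses (l_gt0 : (0 < l)%N) (q2l : l.-primitive_root (q ^+ 2)).
Hypothesis ql : q ^+ l = - (-1) ^+ l.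
Variables (A : algType F) (a b c d : A).
Hypothesis rel : SLq_rels q a b c d.
Let q0 := SLq_root_neq0 l_gt0 ql.

Lemma SLq_root_ad : a ^+ l * d ^+ l = 1 + b ^+ l * c ^+ l.
Proof.
have [_ _ _ bc _] := (SLq_relsP _ _ _ _ _).1 rel.
rewrite (SLq_rels_expr_ad l rel) (SLq_poch_root l_gt0 q2l ql).
by rewrite rmorphD rmorph1 rmorphXn /= horner_algX exprMn_comm.
Qed.

Lemma SLq_root_qcomm u v :
  u * v = q *: (v * u) -> u ^+ l * v ^+ l = v ^+ l * u ^+ l :> A.
Proof. by move=> uv; rewrite (qcommX _ _ uv) SLq_root_expXX // scale1r. Qed.

End RootRelations.

Lemma SLq_root_da (F : fieldType) (q : F) (l : nat) (A : algType F) (a b c d : A) :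
  (0 < l)%N -> l.-primitive_root (q ^+ 2) -> q ^+ l = - (-1) ^+ l ->
  SLq_rels q a b c d -> d ^+ l * a ^+ l = 1 + b ^+ l * c ^+ l.
Proof.
move=> l0 q2l ql rel; have q0 := SLq_root_neq0 l0 ql.
apply: (@SLq_root_ad F q^-1 l) => //; last exact: SLq_rels_sym.
  exact: SLq_root_prim_inv.
by rewrite SLq_root_inv.
Qed.

(** Although a and d do not commute up to a scalar, a and d^l do commute: both
    products are d^(l-1) times a factor 1 + u bc, and the two values of u agree
    since q^(2l) = 1. *)
Lemma SLq_root_a_comm_d (F : fieldType) (q : F) (l : nat) (A : algType F)
    (a b c d : A) :
  (0 < l)%N -> l.-primitive_root (q ^+ 2) -> q != 0 -> SLq_rels q a b c d ->
  a * d ^+ l = d ^+ l * a.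
Proof.
move=> l0 q2l q0 rel.
have [_ _ _ bc [_ ad da]] := (SLq_relsP _ _ _ _ _).1 rel.
rewrite -(prednK l0) exprS mulrA ad -exprS exprSr -(mulrA _ d a) da.
rewrite mulrDr mulrDl mulr1 mul1r; congr (_ + _).
have := SLq_bcd rel 1 1 l.-1; rewrite !expr1 -scalerAl -scalerAr => ->.
rewrite scalerA; congr (_ *: _); apply: (mulfI q0).
rewrite mulfV // mulrA -expr2 -exprD -{1}(prim_expr_order q2l) -exprM.
by congr (_ ^+ _); lia.
Qed.

(** * The two coordinate rings *)
Lemma SLq_rels_morph (F K : fieldType) (A : algType F) (B : algType K)
    (iota : {rmorphism F -> K}) (f : {rmorphism A -> B}) q (a b c d : A) :
  (forall k x, f (k *: x) = iota k *: f x) ->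
  all (fun u => f u == 0) (SLq_relators q a b c d) =
  SLq_rels (iota q) (f a) (f b) (f c) (f d).
Proof.
move=> fZ; rewrite /SLq_rels /= !(rmorphB f, rmorphM f, rmorph1 f, fZ).
by rewrite rmorphB fmorphV.
Qed.

Lemma ord4_ind (P : 'I_4 -> Prop) :
  P (@Ordinal 4 0 isT) -> P (@Ordinal 4 1 isT) ->
  P (@Ordinal 4 2 isT) -> P (@Ordinal 4 3 isT) -> forall i, P i.
Proof.
by move=> P0 P1 P2 P3 [[|[|[|[|//]]]] Hi]; rewrite (bool_irrelevance Hi isT).
Qed.

Section QuantumGroup.
Variables (F : fieldType) (q : F).

Lemma ASLq_rels : SLq_rels q (SLq_a q) (SLq_b q) (SLq_c q) (SLq_d q).
Proof.
have rel : all (fun u => quot_pi (SLq_presentation q) u == 0) (SLq_presentation q).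
  by apply/allP => u /quot_pi_relators ->.
have piZ k x : quot_pi (SLq_presentation q) (k *: x) =
  idfun k *: quot_pi (SLq_presentation q) x by apply: linearZ.
(* The generators are given explicitly: finding them by unification would
   unfold the quotient. *)
pose E := SLq_rels_morph q (free_gen F (@Ordinal 4 0 isT))
  (free_gen F (@Ordinal 4 1 isT)) (free_gen F (@Ordinal 4 2 isT))
  (free_gen F (@Ordinal 4 3 isT)) piZ.
by rewrite E in rel.
Qed.

Lemma ASLq_generate : generate (SLq_a q) (SLq_b q) (SLq_c q) (SLq_d q).
Proof.
move=> M Msub M1 MM x; have [y <-] := quot_pi_surj (P := SLq_presentation q) x.
elim/free_alg_ind: y => [|y z My Mz|k y My|i y My].
- by rewrite rmorph1.
- by rewrite rmorphD; apply: (subspaceD Msub).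
- by rewrite linearZ; apply: (subspaceZ Msub).
rewrite rmorphM; have [Ma Mb Mc Md] := MM _ My.
by move: i; apply: ord4_ind; [exact: Ma|exact: Mb|exact: Mc|exact: Md].
Qed.
End QuantumGroup.

Section ClassicalGroup.
Variable F : fieldType.
Local Notation al := (SL2_alpha F).
Local Notation be := (SL2_beta F).
Local Notation ga := (SL2_gamma F).
Local Notation de := (SL2_delta F).

Lemma ASL2_comm (x y : ASL2 F) : x * y = y * x.
Proof.
have [u <-] := quot_pi_surj (P := SL2_presentation F) x.
have [v <-] := quot_pi_surj (P := SL2_presentation F) y.
by rewrite -!rmorphM mulrC.
Qed.

Lemma ASL2_det : al * de - be * ga = 1.
Proof.
have : quot_pi (SL2_presentation F) (head 0 (SL2_relators F)) = 0.
  by apply: quot_pi_relators; rewrite mem_head.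
rewrite /= !(rmorphB, rmorphM, rmorph1) => /eqP.
by rewrite subr_eq0 => /eqP.
Qed.

(** The classical group is the case q = 1, so the monomials above also span its
    coordinate ring. *)
Lemma ASL2_rels : SLq_rels 1 al be ga de.
Proof.
have det := ASL2_det.
have ad : al * de = 1 + be * ga by rewrite -det subrK.
apply/SLq_relsP; rewrite invr1 !scale1r.
by do ![split]; rewrite ?ad // 1?ASL2_comm.
Qed.

Lemma ASL2_generate : generate al be ga de.
Proof.
move=> M Msub M1 MM x; have [y <-] := quot_pi_surj (P := SL2_presentation F) x.
elim/mpoly_gen_ind: y => [|y z My Mz|k y My|i y My].
- by rewrite rmorph1.
- by rewrite rmorphD; apply: (subspaceD Msub).
- by rewrite linearZ; apply: (subspaceZ Msub).
rewrite rmorphM; have [Ma Mb Mc Md] := MM _ My.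
by move: i; apply: ord4_ind; [exact: Ma|exact: Mb|exact: Mc|exact: Md].
Qed.

Lemma ASL2_lift (A : algType F) (a b c d : A) :
  [/\ a * b = b * a, a * c = c * a & a * d = d * a] ->
  [/\ b * c = c * b, b * d = d * b & c * d = d * c] ->
  a * d = 1 + b * c ->
  exists phi : {lrmorphism ASL2 F -> A},
    [/\ phi al = a, phi be = b, phi ga = c & phi de = d].
Proof.
move=> [ab ac ad] [bc bd cd] det.
pose v (i : 'I_4) := nth 0 [:: a; b; c; d] i.
have vC i j : GRing.comm (v i) (v j).
  by move: i j; apply: ord4_ind; apply: ord4_ind.
have [g [gX gZ]] := mpoly_lift vC.
have [|h hg] := quot_lift (P := SL2_presentation F) (g := g).
  by rewrite /= andbT !(rmorphB, rmorphM, rmorph1) /= !gX /v /= det addrK subrr.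
have hZ : scalable h by move=> k x; apply: (quot_liftZ (s := *:%R) hg gZ).
exists (HB.pack_for {lrmorphism ASL2 F -> A} (h : ASL2 F -> A)
  (GRing.RMorphism.class h) (GRing.isScalable.Build _ _ _ _ (h : ASL2 F -> A) hZ)).
by rewrite /= !hg !gX.
Qed.

Lemma ASL2_ext (A : algType F) (f g : {lrmorphism ASL2 F -> A}) :
  [/\ f al = g al, f be = g be, f ga = g ga & f de = g de] -> f =1 g.
Proof.
move=> [fa fb fc fd]; apply: ASL2_generate => [||x fx].
- split=> [|k x y fx fy]; first by rewrite !rmorph0.
  by rewrite !linearP /= fx fy.
- by rewrite !rmorph1.
by split; rewrite !rmorphM /= fx ?fa ?fb ?fc ?fd.
Qed.

End ClassicalGroup.

(** * The regular representation *)

(** Once a is invertible the relations determine d, and those that involve d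
    follow from the others. *)
Lemma SLq_rels_unit (F : fieldType) (q : F) (A : algType F) (a a' b c : A) :
  q != 0 -> a * a' = 1 -> a' * a = 1 ->
  a * b = q *: (b * a) -> a * c = q *: (c * a) -> b * c = c * b ->
  SLq_rels q a b c (a' * (1 + q *: (b * c))).
Proof.
move=> q0 aa' a'a ab ac bc.
have inv y : a * y = q *: (y * a) -> y * a' = q *: (a' * y).
  move=> ay; rewrite -[y in LHS]mul1r -a'a -(mulrA a') ay -scalerAr -scalerAl.
  by rewrite -!mulrA aa' mulr1.
have t y : y * (b * c) = b * c * y -> y * (1 + q *: (b * c)) = (1 + q *: (b * c)) * y.
  by move=> yt; rewrite mulrDr mulrDl mulr1 mul1r -scalerAr -scalerAl yt.
have tb := t b (ltac:(by rewrite -mulrA -bc)).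
have tc := t c (ltac:(by rewrite mulrA -bc)).
apply/SLq_relsP; split=> //; last split.
- by rewrite mulrA inv // -!scalerAl -!mulrA tb.
- by rewrite mulrA inv // -!scalerAl -!mulrA tc.
- by rewrite mulrA aa' mul1r.
rewrite -mulrA mulrDl mul1r mulrDr a'a -scalerAl -scalerAr; congr (_ + _).
have /(qcommV (expf_neq0 2 q0)) -> : a * (b * c) = q ^+ 2 *: (b * c * a).
  by rewrite (qcommM ab ac) expr2.
rewrite -scalerAr (mulrA a') a'a mul1r scalerA; congr (_ *: _).
by rewrite expr2 invfM mulrA mulfV // mul1r.
Qed.

(** Right multiplication by a, b, c on the left K-space with basis a^m b^n c^s,
    m, n, s < l, where a^l, b^l, c^l act on the left as x, y, z.  Row vectors
    make right multiplication multiplicative. *)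
Section RegularRepresentation.
Variables (K : fieldType) (q x y z : K) (l : nat).
Hypotheses (l_gt0 : (0 < l)%N) (q0 : q != 0) (qll : q ^+ (l * l) = 1).
Hypothesis x0 : x != 0.

Local Notation N := (l ^ 3).-1.+1.
Local Notation V := 'rV[K]_N.

(** Position of a^i b^j c^k, with exponents taken modulo l, in the basis. *)
Definition mon_idx (i j k : nat) := ((i %% l * l + j %% l) * l + k %% l)%N.

Let N_gt0 : N = (l * l * l)%N.
Proof. by rewrite prednK ?expn_gt0 ?l_gt0 // !expnSr expn0 mul1n. Qed.

Lemma mon_idx_lt i j k : (mon_idx i j k < N)%N.
Proof.
rewrite N_gt0 /mon_idx.
have := ltn_pmod i l_gt0; have := ltn_pmod j l_gt0; have := ltn_pmod k l_gt0.
move: (i %% l)%N (j %% l)%N (k %% l)%N => u v w; nia.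
Qed.

Definition idx_a (t : nat) := (t %/ (l * l))%N.
Definition idx_b (t : nat) := (t %/ l %% l)%N.
Definition idx_c (t : nat) := (t %% l)%N.

Lemma mon_idxK (t : 'I_N) : mon_idx (idx_a t) (idx_b t) (idx_c t) = t.
Proof.
have t1 : (idx_a t < l)%N by rewrite /idx_a ltn_divLR ?muln_gt0 ?l_gt0 // mulnA -N_gt0.
rewrite /mon_idx (modn_small t1) /idx_b /idx_c !modn_mod /idx_a divnMA.
by rewrite -!divn_eq.
Qed.

Lemma idx_mon i j k : [/\ idx_a (mon_idx i j k) = i %% l, idx_b (mon_idx i j k) = j %% l
  & idx_c (mon_idx i j k) = k %% l]%N.
Proof.
have k_lt := ltn_pmod k l_gt0; have j_lt := ltn_pmod j l_gt0.
rewrite /idx_a /idx_b /idx_c /mon_idx divnMA !divnMDl // (divn_small k_lt) addn0.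
rewrite !modnMDl !divnMDl // (divn_small j_lt) addn0.
by rewrite !modn_mod.
Qed.

(** The coordinates of a^i b^j c^k for arbitrary exponents.  Extracting b^(l j')
    and c^(l k') to the left of a^i costs the power of q. *)
Definition mon (i j k : nat) : V :=
  (x ^+ (i %/ l) * y ^+ (j %/ l) * z ^+ (k %/ l)
     * q ^+ (i * (l * (j %/ l + k %/ l))))
    *: delta_mx 0 (inord (mon_idx i j k)).

(** The index i does not enter the power of q because q^(l*l) = 1. *)
Lemma mon_wrap i j k u v w :
  mon (i * l + u) (j * l + v) (k * l + w) =
  (x ^+ i * y ^+ j * z ^+ k * q ^+ (u * (l * (j + k)))) *: mon u v w.
Proof.
rewrite /mon scalerA !divnMDl // /mon_idx !modnMDl; congr (_ *: _).
have qq a n : q ^+ (a + n * (l * l)) = q ^+ a.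
  by rewrite exprD [(n * _)%N]mulnC exprM qll expr1n mulr1.
have -> : q ^+ ((i * l + u) * (l * (j + v %/ l + (k + w %/ l)))) =
    q ^+ (u * (l * (j + k))) * q ^+ (u * (l * (v %/ l + w %/ l))).
  rewrite -exprD -[RHS](qq _ (i * (j + v %/ l + (k + w %/ l)))%N).
  by congr (_ ^+ _); ring.
rewrite !exprD; ring.
Qed.

Lemma mon_delta (t : 'I_N) : mon (idx_a t) (idx_b t) (idx_c t) = delta_mx 0 t.
Proof.
have t1 : (idx_a t < l)%N by rewrite /idx_a ltn_divLR ?muln_gt0 ?l_gt0 // mulnA -N_gt0.
rewrite /mon mon_idxK inord_val !divn_small ?ltn_mod // addn0 !muln0 !expr0.
by rewrite !mulr1 scale1r.
Qed.

(** The operator prescribed on the basis only; [mon_regA], [mon_regB] and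
    [mon_regC] then say that the formula holds for all exponents. *)
Definition mon_op (f : nat -> nat -> nat -> V) : 'M[K]_N :=
  \matrix_(t < N) f (idx_a t) (idx_b t) (idx_c t).

Lemma mon_opE f i j k :
  mon i j k *m mon_op f =
  (x ^+ (i %/ l) * y ^+ (j %/ l) * z ^+ (k %/ l)
     * q ^+ (i * (l * (j %/ l + k %/ l)))) *: f (i %% l)%N (j %% l)%N (k %% l)%N.
Proof.
rewrite /mon -scalemxAl -rowE rowK inordK ?mon_idx_lt //.
by have [-> -> ->] := idx_mon i j k.
Qed.

Lemma eq_mon_mx (A B : 'M[K]_N) :
  (forall i j k, mon i j k *m A = mon i j k *m B) -> A = B.
Proof. by move=> AB; apply/row_matrixP => t; rewrite !rowE -mon_delta AB. Qed.

Definition regA : 'M[K]_N :=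
  mon_op (fun i j k => (q ^- (j + k)) *: mon i.+1 j k).
Definition regB : 'M[K]_N := mon_op (fun i j k => mon i j.+1 k).
Definition regC : 'M[K]_N := mon_op (fun i j k => mon i j k.+1).

Let q_wrap i n : q ^+ (i * (l * n)) = q ^+ (i %% l * (l * n)).
Proof.
rewrite {1}(divn_eq i l) mulnDl exprD.
have -> : (i %/ l * l * (l * n) = l * l * (i %/ l * n))%N by ring.
by rewrite exprM qll expr1n mul1r.
Qed.

Lemma mon_regB i j k : mon i j k *m regB = mon i j.+1 k.
Proof.
by rewrite mon_opE q_wrap -mon_wrap addnS -!divn_eq.
Qed.

Lemma mon_regC i j k : mon i j k *m regC = mon i j k.+1.
Proof. by rewrite mon_opE q_wrap -mon_wrap addnS -!divn_eq. Qed.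

Lemma mon_regA i j k : mon i j k *m regA = q ^- (j + k) *: mon i.+1 j k.
Proof.
have -> : mon i.+1 j k = (x ^+ (i %/ l) * y ^+ (j %/ l) * z ^+ (k %/ l) *
    q ^+ ((i %% l).+1 * (l * (j %/ l + k %/ l)))) *: mon (i %% l).+1 (j %% l) (k %% l).
  by rewrite -mon_wrap addnS -!divn_eq.
rewrite mon_opE !scalerA q_wrap; congr (_ *: _).
have -> : (j + k = j %% l + k %% l + l * (j %/ l + k %/ l))%N.
  by rewrite {1}(divn_eq j l) {1}(divn_eq k l); ring.
move: (l * _)%N => n; rewrite mulSn !exprD; field.
by rewrite !expf_neq0.
Qed.

Lemma mon_regAX n i j k :
  mon i j k *m (regA : 'M_N) ^+ n = q ^- ((j + k) * n) *: mon (i + n) j k.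
Proof.
elim: n => [|n IH]; first by rewrite mulmx1 muln0 invr1 scale1r addn0.
rewrite exprSr mulmxA IH -scalemxAl mon_regA scalerA addnS.
by rewrite mulnS [q ^+ (j + k + _)]exprD invfM mulrC.
Qed.

Lemma mon_regBX n i j k : mon i j k *m (regB : 'M_N) ^+ n = mon i (j + n) k.
Proof.
elim: n => [|n IH]; first by rewrite mulmx1 addn0.
by rewrite exprSr mulmxA IH mon_regB addnS.
Qed.

Lemma mon_regCX n i j k : mon i j k *m (regC : 'M_N) ^+ n = mon i j (k + n).
Proof.
elim: n => [|n IH]; first by rewrite mulmx1 addn0.
by rewrite exprSr mulmxA IH mon_regC addnS.
Qed.

(** Period l would leave the sign q^(-l(j+k)); period l*l removes it. *)
Definition regA_inv : 'M[K]_N := x ^- l *: regA ^+ (l * l).-1.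
Definition regD : 'M[K]_N := regA_inv * (1 + q *: (regB * regC)).

Let regA_period : (regA : 'M_N) ^+ (l * l) = (x ^+ l)%:A.
Proof.
apply: eq_mon_mx => i j k; rewrite mon_regAX -scalemxAr mulmx1.
have := mon_wrap l 0 0 i j k.
rewrite !mul0n !add0n muln0 muln0 !expr0 !mulr1 => <-.
by rewrite mulnC exprM qll expr1n invr1 scale1r addnC.
Qed.

Lemma reg_rels : SLq_rels q (regA : 'M_N) regB regC regD.
Proof.
have ll_gt0 : (0 < l * l)%N by rewrite muln_gt0 l_gt0.
have xl0 : x ^+ l != 0 by apply: expf_neq0.
apply: SLq_rels_unit => //.
- by rewrite /regA_inv -scalerAr -exprS prednK // regA_period scalerA mulVf // scale1r.
- by rewrite /regA_inv -scalerAl -exprSr prednK // regA_period scalerA mulVf // scale1r.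
- apply: eq_mon_mx => i j k; rewrite -scalemxAr !mulmxA mon_regA mon_regB.
  rewrite -scalemxAl mon_regA mon_regB [RHS]scalerA; congr (_ *: _).
  by rewrite addSn exprS invfM mulrA mulfV // mul1r.
- apply: eq_mon_mx => i j k; rewrite -scalemxAr !mulmxA mon_regA mon_regC.
  rewrite -scalemxAl mon_regA mon_regC [RHS]scalerA; congr (_ *: _).
  by rewrite addnS exprS invfM mulrA mulfV // mul1r.
by apply: eq_mon_mx => i j k; rewrite !mulmxA !(mon_regB, mon_regC).
Qed.

End RegularRepresentation.

(** * Coordinates on SL(2) *)
Section Coordinates.
Variable F : fieldType.
Local Notation R1 := {poly F}.
Local Notation R2 := {poly R1}.
Local Notation B := (ASL2 F).
Local Notation al := (SL2_alpha F).
Local Notation be := (SL2_beta F).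
Local Notation ga := (SL2_gamma F).
Local Notation de := (SL2_delta F).

(* X, Y, Z are the variables alpha, beta, gamma, with gamma innermost.  The
   field K is kept abstract: of the fraction field only the embedding t of the
   polynomials matters. *)
Variables (K : fieldType) (t : {rmorphism {poly R2} -> K}).
Hypothesis t_inj : injective t.

Definition coordC : {rmorphism F -> K} := t \o (polyC \o (polyC \o polyC)).
Definition coordX : K := t 'X.
Definition coordY : K := t ('X)%:P.
Definition coordZ : K := t ('X)%:P%:P.

Lemma coordX_neq0 : coordX != 0.
Proof. by rewrite -(rmorph0 t) (inj_eq t_inj) polyX_eq0. Qed.

Lemma ASL2_coord : exists chi : {rmorphism B -> K},
  [/\ [/\ chi al = coordX, chi be = coordY, chi ga = coordZ
        & chi de = (1 + coordY * coordZ) / coordX]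
    & forall k x, chi (k *: x) = coordC k * chi x].
Proof.
pose v (i : 'I_4) :=
  nth 0 [:: coordX; coordY; coordZ; (1 + coordY * coordZ) / coordX] i.
pose g : {rmorphism mpoly 4 F -> K} := mpoly.mmap coordC v.
have gX i : g (mpolyX F (mnm1 i)) = v i by rewrite /= mmapX mmap1U.
have [|h hg] := quot_lift (P := SL2_presentation F) (g := g).
  rewrite /= andbT !(rmorphB g, rmorphM g, rmorph1 g) !gX /v /=.
  by rewrite [_ / _]mulrC mulVKf ?coordX_neq0 // addrK subrr.
exists h; split; last first.
  move=> k x; apply: (quot_liftZ (s := fun k y => coordC k * y) hg) => k' x'.
  exact: mpoly.mmapZ.
by split; apply: etrans (hg _) (gX _).
Qed.

Variable chi : {rmorphism B -> K}.
Hypothesis chi_gens : [/\ chi al = coordX, chi be = coordY, chi ga = coordZ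
  & chi de = (1 + coordY * coordZ) / coordX].
Hypothesis chiZ : forall k x, chi (k *: x) = coordC k * chi x.

(* Evaluation of iterated polynomials at gamma, then beta, then alpha (evA) or
   delta (evD). *)
Let ev1 : {rmorphism R1 -> B} := horner_alg ga.
Let ev2_comm : commr_rmorph ev1 be. Proof. by move=> p; apply: ASL2_comm. Qed.
Let ev2 : {rmorphism R2 -> B} := horner_morph ev2_comm.
Let evA_comm : commr_rmorph ev2 al. Proof. by move=> p; apply: ASL2_comm. Qed.
Let evA : {rmorphism {poly R2} -> B} := horner_morph evA_comm.
Let evD_comm : commr_rmorph ev2 de. Proof. by move=> p; apply: ASL2_comm. Qed.
Let evD : {rmorphism {poly R2} -> B} := horner_morph evD_comm.

(** The factor de keeps the constant terms of V from overlapping with U. *)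
Lemma ASL2_normal_form x : exists U V, x = evA U + evD V * de.
Proof.
have evA2 p : evA p%:P = ev2 p by apply: horner_morphC.
have evD2 p : evD p%:P = ev2 p by apply: horner_morphC.
have ev21 p : ev2 p%:P = ev1 p by apply: horner_morphC.
have ev1c k : ev1 k%:P = k%:A by apply: horner_algC.
have mono j k : ev2 ('X^j * ('X^k)%:P) = be ^+ j * ga ^+ k.
  by rewrite rmorphM rmorphXn /= [ev2 'X]horner_morphX ev21 rmorphXn /= [ev1 'X]horner_algX.
apply: (PBW_generate (oner_neq0 F) (@ASL2_rels F) (@ASL2_generate F) x
  (M := fun x => exists U V, x = evA U + evD V * de)).
- split=> [|k u v [U [V ->]] [U' [V' ->]]].
    by exists 0, 0; rewrite !rmorph0 mul0r addr0.
  exists (k%:P%:P%:P * U + U'), (k%:P%:P%:P * V + V').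
  rewrite !rmorphD !rmorphM evA2 evD2 ev21 ev1c !mulr_algl scalerDr mulrDl.
  by rewrite -scalerAl addrACA.
- move=> i j k; exists ('X^i * ('X^j * ('X^k)%:P)%:P), 0.
  by rewrite rmorph0 mul0r addr0 rmorphM rmorphXn /= [evA 'X]horner_morphX evA2 mono mulrA.
move=> j k [|r].
  by exists (('X^j * ('X^k)%:P)%:P), 0; rewrite rmorph0 mul0r addr0 evA2 mono mulr1.
exists 0, (('X^j * ('X^k)%:P)%:P * 'X^r).
rewrite rmorph0 add0r (rmorphM evD) (rmorphXn evD) [evD 'X]horner_morphX evD2 mono.
by rewrite -(mulrA _ _ de) -exprSr.
Qed.

Lemma coord_evA U : chi (evA U) = t U.
Proof.
have [ca cb cc _] := chi_gens.
have evA2 p : evA p%:P = ev2 p by apply: horner_morphC.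
have ev21 p : ev2 p%:P = ev1 p by apply: horner_morphC.
have ev1c k : ev1 k%:P = k%:A by apply: horner_algC.
have chi1 p : chi (ev1 p) = t p%:P%:P.
  elim/poly_ind: p => [|p c IH]; first by rewrite !rmorph0.
  rewrite (rmorphD ev1) (rmorphM ev1) (rmorphD chi) (rmorphM chi) IH ev1c.
  rewrite [ev1 'X]horner_algX cc chiZ rmorph1 mulr1.
  by rewrite !polyCD !polyCM (rmorphD t) (rmorphM t).
have chi2 p : chi (ev2 p) = t p%:P.
  elim/poly_ind: p => [|p c IH]; first by rewrite !rmorph0.
  rewrite (rmorphD ev2) (rmorphM ev2) (rmorphD chi) (rmorphM chi) IH ev21 chi1.
  by rewrite [ev2 'X]horner_morphX cb polyCD polyCM (rmorphD t) (rmorphM t).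
elim/poly_ind: U => [|p c IH]; first by rewrite !rmorph0.
rewrite (rmorphD evA) (rmorphM evA) (rmorphD chi) (rmorphM chi) IH evA2 chi2.
by rewrite [evA 'X]horner_morphX ca (rmorphD t) (rmorphM t).
Qed.

(** Multiplying by X^N, N the size of V, clears the denominators, and the result
    has degree below N: it cannot cancel against t U * X^N. *)
Lemma coord_evD V : chi (evD V * de) * coordX ^+ size V =
  t (\poly_(i < size V)
       (V`_(size V - i.+1) * (1 + 'X * ('X)%:P) ^+ (size V - i))).
Proof.
have [_ _ _ cd] := chi_gens.
have evA2 p : evA p%:P = ev2 p by apply: horner_morphC.
have cdX : chi de * coordX = t (1 + 'X * ('X)%:P)%:P.
  by rewrite cd divfK ?coordX_neq0 // !(rmorphD, rmorphM, rmorph1).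
have -> : evD V = (map_poly ev2 V).[de] by [].
rewrite (horner_coef_wide _ (size_poly _ _)) mulr_suml.
rewrite (rmorph_sum chi) mulr_suml.
rewrite [in RHS]poly_def rmorph_sum [RHS](reindex_inj rev_ord_inj) /=.
apply: eq_bigr => i _.
have iN := ltn_ord i; set j := (size V - i.+1)%N.
have -> : (size V - j = i.+1)%N by rewrite /j subKn.
have -> : (size V - j.+1 = i)%N by rewrite /j subnSK // subKn // ltnW.
have -> : coordX ^+ size V = coordX ^+ i.+1 * coordX ^+ j.
  by rewrite -exprD /j subnKC.
rewrite -mulrA -exprSr rmorphM rmorphXn.
rewrite coef_map /= -evA2 coord_evA.
rewrite -!mulrA [chi de ^+ _ * _]mulrA -exprMn cdX -mul_polyC.
by rewrite !(rmorphM, rmorphXn) /= mulrA.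
Qed.

(** In (U + V) X^N = 0 the terms from U have degree at least N and those from V
    degree below N; both vanish, and 1 + YZ is not a zero divisor. *)
Lemma coord_inj : injective chi.
Proof.
suff chi0 x : chi x = 0 -> x = 0.
  move=> u v /eqP; rewrite -subr_eq0 -rmorphB => /eqP/chi0/eqP.
  by rewrite subr_eq0 => /eqP.
have [U [V ->]] := ASL2_normal_form x.
rewrite rmorphD coord_evA => /(congr1 ( *%R^~ (coordX ^+ size V))).
rewrite mul0r mulrDl coord_evD -rmorphXn -rmorphM -rmorphD.
set W := \poly_(i < _) _; rewrite -(rmorph0 t) => /t_inj UW.
have U0 : U = 0.
  apply/polyP=> i; have := congr1 (fun p : {poly R2} => p`_(size V + i)) UW.
  rewrite /= coefD coefMXn coef_poly !coef0 ltnNge leq_addr /= addr0.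
  by rewrite addKn.
move: UW; rewrite U0 mul0r add0r => W0.
suff -> : V = 0 by rewrite !rmorph0 mul0r addr0.
apply/polyP=> i; rewrite coef0; have [iV|] := ltnP i (size V); last first.
  by move=> ?; rewrite nth_default.
have := congr1 (fun p : {poly R2} => p`_(size V - i.+1)) W0.
rewrite /= coef_poly coef0 ifT; last by rewrite ltn_subrL (leq_ltn_trans _ iV).
rewrite subnSK // subKn ?(ltnW iV) //.
move/eqP; rewrite mulf_eq0 => /orP[/eqP //|]; rewrite expf_eq0 => /andP[_].
move=> /eqP/(congr1 (fun p : R2 => p.[0])).
by rewrite !hornerE /= => /eqP; rewrite oner_eq0.
Qed.

End Coordinates.

(** * Independence over the classical coordinate ring *)
Lemma ASLq_lift (F K : fieldType) (q : F) (iota : {rmorphism F -> K})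
    (S : algType K) (a b c d : S) :
  SLq_rels (iota q) a b c d ->
  exists R : {rmorphism ASLq q -> S},
    [/\ R (SLq_a q) = a, R (SLq_b q) = b, R (SLq_c q) = c & R (SLq_d q) = d]
    /\ forall k x, R (k *: x) = iota k *: R x.
Proof.
move=> rel; pose v (i : 'I_4) := nth 0 [:: a; b; c; d] i.
have [k s|g [gX gZ]] := free_lift (f := in_alg S \o iota) v.
  by rewrite /GRing.comm /= mulr_algl mulr_algr.
have {}gZ k x : g (k *: x) = iota k *: g x by rewrite gZ /= mulr_algl.
have [|R Rg] := quot_lift (P := SLq_presentation q) (g := g).
  apply: etrans (SLq_rels_morph q (free_gen F (@Ordinal 4 0 isT))
    (free_gen F (@Ordinal 4 1 isT)) (free_gen F (@Ordinal 4 2 isT))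
    (free_gen F (@Ordinal 4 3 isT)) gZ) _.
  by rewrite !gX.
exists R; split; last exact: (quot_liftZ (s := fun k y => iota k *: y) Rg gZ).
by split; apply: etrans (Rg _) (gX _).
Qed.

(** The quantum Frobenius map. *)
Lemma SLq_frobenius (F : fieldType) (q : F) (l : nat) (A : algType F)
    (a b c d : A) :
  (0 < l)%N -> l.-primitive_root (q ^+ 2) -> q ^+ l = - (-1) ^+ l ->
  SLq_rels q a b c d ->
  exists phi : {lrmorphism ASL2 F -> A},
    [/\ phi (SL2_alpha F) = a ^+ l, phi (SL2_beta F) = b ^+ l,
        phi (SL2_gamma F) = c ^+ l & phi (SL2_delta F) = d ^+ l].
Proof.
move=> l_gt0 q2l ql rel.
have [ab ac bd bc [cd _ _]] := (SLq_relsP _ _ _ _ _).1 rel.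
have ad := SLq_root_ad l_gt0 q2l ql rel.
have comm (u v : A) : u * v = q *: (v * u) -> u ^+ l * v ^+ l = v ^+ l * u ^+ l.
  by move=> uv; apply: (SLq_root_qcomm _ uv).
apply: ASL2_lift; [split|split|exact: ad].
- exact: comm.
- exact: comm.
- by rewrite ad (SLq_root_da l_gt0 q2l ql rel).
- by apply/commrX/commr_sym/commrX/commr_sym.
- exact: comm.
- exact: comm.
Qed.

Section MainLemmas.
Variables (F : fieldType) (q : F) (l : nat).
Hypotheses (l_gt0 : (0 < l)%N) (q2l : l.-primitive_root (q ^+ 2)).
Hypothesis ql : q ^+ l = - (-1) ^+ l.

Local Notation B := (ASL2 F).
Local Notation A := (ASLq q).
Local Notation al := (SL2_alpha F).
Local Notation be := (SL2_beta F).
Local Notation ga := (SL2_gamma F).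
Local Notation de := (SL2_delta F).
Local Notation a := (SLq_a q).
Local Notation b := (SLq_b q).
Local Notation c := (SLq_c q).
Local Notation d := (SLq_d q).

Let q0 : q != 0 := SLq_root_neq0 l_gt0 ql.
Let rel : SLq_rels q a b c d := ASLq_rels q.

Variable phi : {lrmorphism B -> A}.
Hypothesis phi_gens :
  [/\ phi al = a ^+ l, phi be = b ^+ l, phi ga = c ^+ l & phi de = d ^+ l].

Local Notation N := (l ^ 3).-1.+1.
Variables (K : fieldType) (tof : {rmorphism {poly {poly {poly F}}} -> K}).
Hypothesis tof_inj : injective tof.

(** L is the coordinate map of A as a left module, after alpha is inverted: the
    image of 1 under the matrix of right multiplication.  It is B-linear because
    the row of 1 is a common eigenvector for the image of B. *)
Lemma frobenius_regular : exists (chi : {rmorphism B -> K})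
    (L : A -> 'rV[K]_N),
  [/\ injective chi,
      L 0 = 0 /\ (forall x y, L (x + y) = L x + L y),
      forall k x, L (phi k * x) = chi k *: L x
    & forall t : 'I_N, L (a ^+ idx_a l t * b ^+ idx_b l t * c ^+ idx_c l t) = delta_mx 0 t].
Proof.
have [chi [chi_gens chiZ]] := ASL2_coord tof_inj.
have chi_inj := coord_inj tof_inj chi_gens chiZ.
pose x := coordX tof; pose y := coordY tof; pose z := coordZ tof.
pose iota := coordC tof.
have x0 : x != 0 by apply: coordX_neq0.
have qi0 : iota q != 0 by rewrite fmorph_eq0.
have qll : iota q ^+ (l * l) = 1 by rewrite -rmorphXn SLq_root_expXX // rmorph1.
have [R [[Ra Rb Rc Rd] RZ]] :=
  ASLq_lift (reg_rels y z l_gt0 qi0 qll x0).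
pose v0 : 'rV_N := mon (iota q) x y z l 0 0 0.
pose L (w : A) : 'rV[K]_N := v0 *m R w.
have LD u w : L (u + w) = L u + L w by rewrite /L rmorphD mulmxDr.
have LM u w : L (u * w) = L u *m R w by rewrite /L rmorphM mulmxA.
have L1 : L 1 = v0 by rewrite /L rmorph1 mulmx1.
have Lmon i j k : L (a ^+ i * b ^+ j * c ^+ k) = mon (iota q) x y z l i j k.
  rewrite !LM /L !rmorphXn Ra Rb Rc mon_regAX // mul0n invr1 scale1r.
  by rewrite mon_regBX // mon_regCX.
have wrap i j k : mon (iota q) x y z l (i * l) (j * l) (k * l) =
    (x ^+ i * y ^+ j * z ^+ k) *: v0.
  by have := mon_wrap x y z l_gt0 qll i j k 0 0 0; rewrite !addn0 mul0n mulr1.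
have v0_phi k : L (phi k) = chi k *: v0.
  have [pa pb pc pd] := phi_gens; have [ca cb cc cd] := chi_gens.
  have La : L (phi al) = chi al *: v0.
    have := Lmon l 0%N 0%N; have := wrap 1%N 0%N 0%N.
    by rewrite !mul1n !mul0n !mulr1 pa ca => -> ->.
  have Lb : L (phi be) = chi be *: v0.
    have := Lmon 0%N l 0%N; have := wrap 0%N 1%N 0%N.
    by rewrite !mul1n !mul0n !mulr1 !mul1r pb cb => -> ->.
  have Lc : L (phi ga) = chi ga *: v0.
    have := Lmon 0%N 0%N l; have := wrap 0%N 0%N 1%N.
    by rewrite !mul1n !mul0n !mul1r pc cc => -> ->.
  (* The relation a^l d^l = 1 + b^l c^l gives x L(d^l), and x is invertible. *)
  have Ld : L (phi de) = chi de *: v0.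
    apply: (scalerI x0); rewrite scalerA cd mulrC divfK //.
    have -> : x *: L (phi de) = L (phi al * phi de) by rewrite LM La ca -scalemxAl.
    rewrite pa pd (SLq_root_ad l_gt0 q2l ql rel) LD L1 -pb -pc LM Lb.
    by rewrite -scalemxAl -/(L _) Lc scalerA cb cc scalerDl scale1r.
  have step g w : L (phi g) = chi g *: v0 -> L (phi w) = chi w *: v0 ->
      L (phi (g * w)) = chi (g * w) *: v0.
    by move=> Lg Lw; rewrite !rmorphM LM Lg -scalemxAl -/(L _) Lw scalerA.
  apply: (ASL2_generate (M := fun k => L (phi k) = chi k *: v0)).
  - split; first by rewrite !rmorph0 scale0r /L rmorph0 mulmx0.
    move=> h u w Lu Lw; rewrite linearP LD rmorphD chiZ scalerDl -scalerA -Lu -Lw.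
    by rewrite /L RZ -scalemxAr.
  - by rewrite !rmorph1 L1 scale1r.
  by move=> w Lw; split; apply: step.
exists chi, L; split=> //.
- by split=> //; rewrite /L rmorph0 mulmx0.
- by move=> k w; rewrite LM v0_phi -scalemxAl.
by move=> t; rewrite Lmon mon_delta.
Qed.

(** Spanning implies independence for families of l^3 elements: the square
    matrix E of their coordinates has a left inverse P, whose rows express the
    products a^m b^n c^s in the family. *)
Lemma frobenius_span_free (I : finType) (e : I -> A) : #|I| = (l ^ 3)%N ->
  (forall w, exists k : I -> B, w = \sum_i phi (k i) * e i) ->
  forall k : I -> B, \sum_i phi (k i) * e i = 0 -> forall i, k i = 0.
Proof.
have [chi [L [chi_inj [L0 LD] Lphi Ldelta]]] := frobenius_regular.
move=> cardI span k k0.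
have Lsum (h : I -> B) : L (\sum_i phi (h i) * e i) =
    \sum_(i < #|I|) chi (h (enum_val i)) *: L (e (enum_val i)).
  rewrite (big_morph L LD L0) -(big_enum_val (fun i => chi (h i) *: L (e i))) /=.
  by apply: eq_big => // i _; apply: Lphi.
pose E : 'M[K]_(#|I|, N) := \matrix_i L (e (enum_val i)).
have Erow (h : I -> B) :
    (\row_i chi (h (enum_val i))) *m E = L (\sum_i phi (h i) * e i).
  rewrite Lsum mulmx_sum_row; apply: eq_bigr => i _.
  by rewrite mxE rowK.
have NE : N = #|I| by rewrite cardI prednK // expn_gt0 l_gt0.
have /choice[P HP] (t : 'I_N) := span (a ^+ idx_a l t * b ^+ idx_b l t * c ^+ idx_c l t).
have PE : (\matrix_t \row_i chi (P t (enum_val i))) *m E = 1%:M.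
  by apply/row_matrixP => t; rewrite row_mul rowK Erow -HP Ldelta row1.
have Efull : row_full E by apply/row_fullP; eexists; exact: PE.
have Efree : row_free E by rewrite /row_free (eqP Efull) -NE.
have u0 : (\row_i chi (k (enum_val i)) : 'rV[K]_(#|I|)) = 0.
  by apply/eqP; rewrite -(mulmx_free_eq0 _ Efree) Erow k0 L0.
move=> i; apply: chi_inj; rewrite rmorph0.
have := congr1 (fun u : 'rV_(#|I|) => u 0 (enum_rank i)) u0.
by rewrite !mxE enum_rankK.
Qed.

End MainLemmas.

(** * From left modules to right modules *)
Section Twisting.
Variables (F : fieldType) (A : algType F).
Local Notation B := (ASL2 F).
Local Notation al := (SL2_alpha F).
Local Notation be := (SL2_beta F).
Local Notation ga := (SL2_gamma F).
Local Notation de := (SL2_delta F).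

(** The signs on beta and gamma agree, as do those on alpha and delta, so the
    determinant is preserved. *)
Lemma ASL2_sign (u v : F) : u * u = 1 -> v * v = 1 ->
  exists tau : {lrmorphism B -> B},
    [/\ tau al = u *: al, tau be = v *: be, tau ga = v *: ga & tau de = u *: de]
    /\ involutive tau.
Proof.
move=> uu vv.
have det : (u *: al) * (u *: de) = 1 + (v *: be) * (v *: ga).
  rewrite -!scalerAl -!scalerAr !scalerA uu vv !scale1r.
  by rewrite -(ASL2_det F) subrK.
have [tau [ta tb tc td]] := @ASL2_lift F B (u *: al) (v *: be) (v *: ga) (u *: de)
  (And3 (ASL2_comm _ _) (ASL2_comm _ _) (ASL2_comm _ _))
  (And3 (ASL2_comm _ _) (ASL2_comm _ _) (ASL2_comm _ _)) det.
exists tau; split=> //.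
pose tau2 : {lrmorphism B -> B} := tau \o tau.
apply: (@ASL2_ext F B tau2 idfun); rewrite /tau2 /=.
by rewrite ta tb tc td !linearZ /= ta tb tc td !scalerA uu vv !scale1r.
Qed.

Variable phi : {lrmorphism B -> A}.

Definition twists (e : A) :=
  exists tau : {lrmorphism B -> B},
    bijective tau /\ forall k, e * phi k = phi (tau k) * e.

Lemma twists1 : twists 1.
Proof.
exists idfun; split; first by exists idfun.
by move=> k; rewrite mul1r mulr1.
Qed.

Lemma twistsM e f : twists e -> twists f -> twists (e * f).
Proof.
move=> [s [s_bij se]] [t [t_bij te]]; exists (s \o t).
split; first exact: bij_comp.
by move=> k; rewrite -mulrA te mulrA se /= mulrA.
Qed.

Lemma twistsX e n : twists e -> twists (e ^+ n).
Proof.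
move=> te; elim: n => [|n IH]; first exact: twists1.
by rewrite exprS; apply: twistsM.
Qed.

Lemma twists_sign (u v : F) (e : A) : u * u = 1 -> v * v = 1 ->
  e * phi al = u *: (phi al * e) -> e * phi be = v *: (phi be * e) ->
  e * phi ga = v *: (phi ga * e) -> e * phi de = u *: (phi de * e) ->
  twists e.
Proof.
move=> uu vv ea eb ec ed.
have [tau [[ta tb tc td] tauK]] := ASL2_sign uu vv.
exists tau; split; first by exists tau.
have step g w x : tau g = x *: g -> e * phi g = x *: (phi g * e) ->
    e * phi w = phi (tau w) * e -> e * phi (g * w) = phi (tau (g * w)) * e.
  move=> tg eg ew; rewrite !rmorphM /= (mulrA e) eg -scalerAl -(mulrA (phi g)) ew tg.
  by rewrite linearZ -!scalerAl mulrA.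
apply: (ASL2_generate (M := fun k => e * phi k = phi (tau k) * e)).
- split=> [|h x y ex ey]; first by rewrite !rmorph0 mulr0 mul0r.
  by rewrite !linearP mulrDr mulrDl -scalerAr -scalerAl ex ey.
- by rewrite !rmorph1 mulr1 mul1r.
move=> w ew; split.
- exact: step ta ea ew.
- exact: step tb eb ew.
- exact: step tc ec ew.
exact: step td ed ew.
Qed.

Definition left_basis (I : finType) (e : I -> A) :=
  (forall w, exists k : I -> B, w = \sum_i phi (k i) * e i) /\
  (forall k : I -> B, \sum_i phi (k i) * e i = 0 -> forall i, k i = 0).

Definition right_basis (I : finType) (e : I -> A) :=
  (forall w, exists k : I -> B, w = \sum_i e i * phi (k i)) /\
  (forall k : I -> B, \sum_i e i * phi (k i) = 0 -> forall i, k i = 0).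

(** The automorphism of each basis element transports the coefficients from one
    side to the other. *)
Lemma twists_right_basis (I : finType) (e : I -> A) :
  (forall i, twists (e i)) -> left_basis e -> right_basis e.
Proof.
move=> /choice[tau tauP] [span free]; split.
  move=> w; have [k ->] := span w.
  have /choice[h hP] (i : I) : exists x, tau i x = k i.
    by have [[s _ sK] _] := tauP i; exists (s (k i)).
  exists h; apply: eq_bigr => i _; have [_ ->] := tauP i.
  by rewrite hP.
move=> k k0 i; have [t_bij _] := tauP i.
apply: (bij_inj t_bij); rewrite rmorph0.
apply: (free (fun i => tau i (k i))); rewrite -[RHS]k0.
by apply: eq_bigr => j _; have [_ ->] := tauP j.
Qed.
End Twisting.

Section Twisted.
Variables (F : fieldType) (q : F) (l : nat) (A : algType F) (a b c d : A).
Hypotheses (l_gt0 : (0 < l)%N) (q2l : l.-primitive_root (q ^+ 2)).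
Hypothesis ql : q ^+ l = - (-1) ^+ l.
Hypothesis rel : SLq_rels q a b c d.
Variable phi : {lrmorphism ASL2 F -> A}.
Hypothesis phi_gens : [/\ phi (SL2_alpha F) = a ^+ l, phi (SL2_beta F) = b ^+ l,
  phi (SL2_gamma F) = c ^+ l & phi (SL2_delta F) = d ^+ l].

(** For b and c the scalar is q^l = q^(-l) in front of alpha and delta; for a and
    d it is in front of beta and gamma. *)
Lemma SLq_twists : [/\ twists phi a, twists phi b, twists phi c & twists phi d].
Proof.
have q0 := SLq_root_neq0 l_gt0 ql.
have [ab ac bd bc [cd _ _]] := (SLq_relsP _ _ _ _ _).1 rel.
have [pa pb pc pd] := phi_gens.
have ee := SLq_root_sqr ql; have eV := SLq_root_inv l_gt0 ql.
have aD := SLq_root_a_comm_d l_gt0 q2l q0 rel.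
have dA : d * a ^+ l = a ^+ l * d.
  apply: (SLq_root_a_comm_d l_gt0 _ _ (SLq_rels_sym q0 rel)).
    exact: (SLq_root_prim_inv l_gt0 q2l ql).
  by rewrite invr_eq0.
have bcl : GRing.comm b (c ^+ l) by apply: commrX.
have cbl : GRing.comm c (b ^+ l) by apply/commrX/commr_sym.
split.
- apply: (@twists_sign _ _ phi 1 (q ^+ l)); rewrite ?pa ?pb ?pc ?pd ?mulr1 ?scale1r //.
  + by rewrite -exprS exprSr.
  + exact: qcommXr.
  + exact: qcommXr.
- apply: (@twists_sign _ _ phi (q ^+ l) 1); rewrite ?pa ?pb ?pc ?pd ?mulr1 ?scale1r //.
  + by rewrite -eV; apply: qcommXr; apply: qcommV.
  + by rewrite -exprS exprSr.
  + exact: qcommXr.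
- apply: (@twists_sign _ _ phi (q ^+ l) 1); rewrite ?pa ?pb ?pc ?pd ?mulr1 ?scale1r //.
  + by rewrite -eV; apply: qcommXr; apply: qcommV.
  + by rewrite -exprS exprSr.
  + exact: qcommXr.
apply: (@twists_sign _ _ phi 1 (q ^+ l)); rewrite ?pa ?pb ?pc ?pd ?mulr1 ?scale1r //.
+ by rewrite -eV; apply: qcommXr; apply: qcommV.
+ by rewrite -eV; apply: qcommXr; apply: qcommV.
by rewrite -exprS exprSr.
Qed.
End Twisted.

(** * The basis of monomials *)

(** Replacing r by the residue of l - r modulo l identifies the triples
    (n, s, r) of the second kind with the triples (m, n, s) that are not of the
    first kind. *)
Lemma card_SLq_index (l : nat) : (0 < l)%N ->
  #|{: {x | @range_mns l x} + {x | @range_nsr l x}}| = (l ^ 3)%N.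
Proof.
move=> l_gt0; rewrite card_sum !card_sig.
pose g (x : 'I_l * 'I_l * 'I_l) : 'I_l * 'I_l * 'I_l :=
  let: (n, s, r) := x in (Ordinal (ltn_pmod (l - r) l_gt0), n, s).
have g_inj : injective g.
  move=> [[n s] r] [[n' s'] r'] [] rr -> ->; congr (_, _, _); apply: val_inj => /=.
  have := ltn_ord r; have := ltn_ord r'; move: rr.
  move: (val r) (val r') => {}r {}r'.
  have [->|r0] := posnP r; have [->|r0'] := posnP r' => //.
  - by rewrite subn0 modnn modn_small; lia.
  - by rewrite subn0 modnn modn_small; lia.
  by rewrite !modn_small; lia.
have -> : #|@range_nsr l| = #|[predC @range_mns l]|.
  rewrite -!sum1_card [RHS](reindex_inj g_inj) /=; apply: eq_bigl.
  move=> [[n s] r]; rewrite !inE !unfold_in /=.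
  have := ltn_ord r; have := ltn_ord n; have := ltn_ord s.
  move: (val r) (val n) (val s) => {}r {}n {}s.
  have [->|r0] := posnP r; first by rewrite subn0 modnn; lia.
  by rewrite modn_small; lia.
rewrite cardC !card_prod card_ord expnS expnS expn1; lia.
Qed.

Lemma free_of_rank_card (R : nzRingType) (M : lmodType R) (I : finType)
    (e : I -> M) n : is_basis e -> #|I| = n -> free_of_rank M n.
Proof.
move=> [span free] <-; exists (fun i => e (enum_val i)).
have sumE (k : 'I_#|I| -> R) :
    \sum_i k i *: e (enum_val i) = \sum_i k (enum_rank i) *: e i.
  rewrite [RHS](reindex (@enum_val I I)) /=; last first.
    exact: onW_bij (enum_val_bij I).
  by apply: eq_bigr => i _; rewrite enum_valK.
split=> [x|k k0 i].
  have [k ->] := span x; exists (fun i => k (enum_val i)).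
  by rewrite sumE; apply: eq_bigr => i _; rewrite enum_rankK.
by rewrite -(enum_valK i); apply: (free (k \o enum_rank)); rewrite -sumE.
Qed.

Section Basis.
Variables (F : fieldType) (q : F) (l : nat).
Hypotheses (l_gt0 : (0 < l)%N) (q2l : l.-primitive_root (q ^+ 2)).
Hypothesis ql : q ^+ l = - (-1) ^+ l.
Variable phi : {lrmorphism ASL2 F -> ASLq q}.
Hypothesis phi_gens : [/\ phi (SL2_alpha F) = SLq_a q ^+ l,
  phi (SL2_beta F) = SLq_b q ^+ l,
  phi (SL2_gamma F) = SLq_c q ^+ l & phi (SL2_delta F) = SLq_d q ^+ l].

Lemma SLq_monomial_span w :
  exists k, w = \sum_i phi (k i) * @SLq_monomial F q l i.
Proof.
pose M w := exists k, w = \sum_i phi (k i) * @SLq_monomial F q l i.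
have [pa pb pc pd] := phi_gens.
have Msub : subspace M.
  split; first by exists (fun=> 0); rewrite big1 // => i _; rewrite rmorph0 mul0r.
  move=> h x y [k ->] [k' ->]; exists (fun i => h *: k i + k' i).
  rewrite scaler_sumr -big_split; apply: eq_bigr => i _.
  by rewrite linearP mulrDl -scalerAl.
have MM g x : M x -> M (phi g * x).
  move=> [k ->]; exists (fun i => g * k i); rewrite mulr_sumr.
  by apply: eq_bigr => i _; rewrite rmorphM mulrA.
have Me i : M (@SLq_monomial F q l i).
  exists (fun j => (j == i)%:R); rewrite (bigD1 i) //= eqxx rmorph1 mul1r.
  by rewrite big1 ?addr0 // => j /negbTE ->; rewrite rmorph0 mul0r.
apply: (SLq_span (SLq_root_neq0 l_gt0 ql) (ASLq_rels q) l_gt0 Msub);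
  last exact: ASLq_generate.
- by move=> x; rewrite -pa; apply: MM.
- by move=> x; rewrite -pb; apply: MM.
- by move=> x; rewrite -pc; apply: MM.
- by move=> x; rewrite -pd; apply: MM.
- move=> m n s mI nI sI.
  have ml : (m < l)%N by case/andP: mI. have sl : (s < l)%N by case/andP: sI.
  have P : @range_mns l (Ordinal ml, Ordinal nI, Ordinal sl).
    by rewrite /=; lia.
  exact (Me (inl (exist (fun x => range_mns x) _ P))).
move=> n s r nI rI srI.
have sl : (s < l)%N by lia.
have P : @range_nsr l (Ordinal nI, Ordinal sl, Ordinal rI) by rewrite /=; lia.
exact (Me (inr (exist (fun x => range_nsr x) _ P))).
Qed.

Lemma SLq_monomial_left_basis : left_basis phi (@SLq_monomial F q l).
Proof.
pose frac : {rmorphism {poly {poly {poly F}}} -> {fraction {poly {poly {poly F}}}}} :=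
  @FracField.tofrac _.
have frac_inj : injective frac by move=> u v /eqP; rewrite tofrac_eq => /eqP.
split; first exact: SLq_monomial_span.
apply: (frobenius_span_free l_gt0 q2l ql phi_gens frac_inj).
  exact: card_SLq_index.
exact: SLq_monomial_span.
Qed.

Lemma SLq_monomial_right_basis : right_basis phi (@SLq_monomial F q l).
Proof.
apply: twists_right_basis SLq_monomial_left_basis.
have [ta tb tc td] := SLq_twists l_gt0 q2l ql (ASLq_rels q) phi_gens.
by case=> -[[[u v] w] uvw]; apply: twistsM; try apply: twistsM; apply: twistsX.
Qed.

(** If phi k = 0, the combination of the basis with all coefficients equal to k
    vanishes. *)
Lemma frobenius_inj : injective phi.
Proof.
have [_ free] := SLq_monomial_left_basis.
suff phi0 k : phi k = 0 -> k = 0.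
  move=> u v /eqP; rewrite -subr_eq0 -rmorphB => /eqP/phi0/eqP.
  by rewrite subr_eq0 => /eqP.
move=> k0; have N0 : (0 < #|{: {x | @range_mns l x} + {x | @range_nsr l x}}|)%N.
  by rewrite card_SLq_index // expn_gt0 l_gt0.
apply: (free (fun=> k) _ (enum_val (Ordinal N0))).
by rewrite big1 // => i _; rewrite k0 mul0r.
Qed.

End Basis.

Theorem ASLq_free (F : fieldType) (l : nat) (q : F) :
  (0 < l)%N -> l.-primitive_root (q ^+ 2) -> q ^+ l = - (-1) ^+ l ->
  exists phi : {lrmorphism ASL2 F -> ASLq q},
    [/\ [/\ phi (SL2_alpha F) = SLq_a q ^+ l,
            phi (SL2_beta F) = SLq_b q ^+ l,
            phi (SL2_gamma F) = SLq_c q ^+ l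
          & phi (SL2_delta F) = SLq_d q ^+ l],
        injective phi,
        free_of_rank (left_module phi) (l ^ 3),
        free_of_rank (right_module phi) (l ^ 3)
      & is_basis (M := left_module phi) (@SLq_monomial F q l) /\
        is_basis (M := right_module phi) (@SLq_monomial F q l)].
Proof.
move=> l_gt0 q2l ql.
have [phi phi_gens] := SLq_frobenius l_gt0 q2l ql (ASLq_rels q).
exists phi.
have Lb : is_basis (M := left_module phi) (@SLq_monomial F q l).
  exact: SLq_monomial_left_basis.
have Rb : is_basis (M := right_module phi) (@SLq_monomial F q l).
  exact: SLq_monomial_right_basis.
split=> //.
- exact: frobenius_inj phi_gens.
- exact: (free_of_rank_card Lb (card_SLq_index l_gt0)).
- exact: (free_of_rank_card Rb (card_SLq_index l_gt0)).
Qed.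

Lemma primitive_root_sqr (F : fieldType) (l : nat) (q : F) :
  odd l /\ l.-primitive_root q \/ ~~ odd l /\ (2 * l).-primitive_root q ->
  l.-primitive_root (q ^+ 2) /\ q ^+ l = - (-1) ^+ l.
Proof.
rewrite -signr_odd; case=> [[lo ql]|[le ql]].
  rewrite lo expr1 opprK (prim_expr_order ql); split=> //.
  by rewrite (prim_root_exp_coprime _ ql) coprime2n.
have l2 : (0 < 2 * l)%N := prim_order_gt0 ql.
split.
  have := dvdn_prim_root ql (dvdn_mull 2 (dvdnn l)).
  by rewrite mulnK //; lia.
rewrite (negbTE le) expr0.
have /eqP : q ^+ l ^+ 2 = 1 by rewrite -exprM mulnC (prim_expr_order ql).
rewrite sqrf_eq1 => /orP[|/eqP //].
by rewrite -(prim_order_dvd ql) => /dvdn_leq; lia.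
Qed.

Theorem proposition2 (R : realType) (l : nat) (q : R[i]) :
  (1 <= l)%N ->
  odd l /\ l.-primitive_root q \/ ~~ odd l /\ (2 * l).-primitive_root q ->
  exists phi : {lrmorphism ASL2 R[i] -> ASLq q},
    [/\ [/\ phi (SL2_alpha R[i]) = SLq_a q ^+ l,
            phi (SL2_beta R[i]) = SLq_b q ^+ l,
            phi (SL2_gamma R[i]) = SLq_c q ^+ l
          & phi (SL2_delta R[i]) = SLq_d q ^+ l],
        injective phi,
        free_of_rank (left_module phi) (l ^ 3),
        free_of_rank (right_module phi) (l ^ 3)
      & is_basis (M := left_module phi) (@SLq_monomial R[i] q l) /\
        is_basis (M := right_module phi) (@SLq_monomial R[i] q l)].
Proof.
move=> l_gt0 /primitive_root_sqr[q2l ql].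
exact: ASLq_free.
Qed.
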